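(* Let $n=3$ and fix $i\in\{1,2,3\}$. Let $\Sigma$ be an immersed oriented spacelike codimension two submanifold of the Minkowski spacetime $\mathbb{R}^{3,1}$ such that $\partial\Sigma$ lies in the de Sitter sphere $\mathbf{S}^{2,1}$ and $\Sigma$ meets $\mathbf{S}^{2,1}$ orthogonally. Then for any null normal vector field $\underline{L}$ of $\Sigma$, $$\int_{\Sigma}\Bigl[(n-1)\langle\xi,\underline{L}\rangle+Q(\vec{H},\underline{L})+Q\bigl(\partial_a,(D^a\underline{L})^{\bot}\bigr)\Bigr]\,d\mu=0 .$$
   Context: $\mathbb{R}^{3,1}$ has coordinates $(x^0,x^1,x^2,x^3)$, metric $\langle\cdot,\cdot\rangle=-(dx^0)^2+\sum_{j=1}^3(dx^j)^2$ and Levi-Civita connection $D$. The de Sitter sphere is $\mathbf{S}^{2,1}=\{x:\langle x,x\rangle=1\}$. Put $\mathcal{D}=-x^0dx^0+\sum_{j=1}^3x^jdx^j$ and $\mathcal{L}_{0i}=-x^0dx^i+x^idx^0$, and let $$Q=\mathcal{D}\wedge\mathcal{L}_{0i}+\tfrac12\bigl[1+\langle\mathcal{D},\mathcal{D}\rangle\bigr]dx^0\wedge dx^i,\qquad \xi=\tfrac1n\operatorname{div}Q=\mathcal{L}_{0i},$$ where $(\alpha\wedge\beta)(X,Y)=\alpha(X)\beta(Y)-\alpha(Y)\beta(X)$ and $(\operatorname{div}Q)_\nu=D^\mu Q_{\mu\nu}$; $\langle\xi,\underline{L}\rangle$ is the pairing $\xi(\underline{L})$. ''$\Sigma$ meets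 $\mathbf{S}^{2,1}$ orthogonally'' means that along $\partial\Sigma$ the position vector $x$ (normal to $\mathbf{S}^{2,1}$) is tangent to $\Sigma$. $\vec{H}$ is the mean curvature vector of $\Sigma$, the trace over $\Sigma$ of $(X,Y)\mapsto(D_XY)^{\bot}$, where $\bot$ denotes projection onto the normal bundle of $\Sigma$. In local coordinates $u^a$ on $\Sigma$ with coordinate vector fields $\partial_a$, indices are raised with the induced metric and repeated indices are summed; $d\mu$ is the induced area measure.
   Formalization: The submanifold Σ (with its boundary) is taken to be compact; without compactness the identity fails, e.g. for an off-centre open disc in a spacelike plane with a constant null normal field. *)

(* Defs.v *)
From mathcomp Require Import all_boot all_order all_algebra.
From mathcomp Require Import all_classical all_reals all_analysis.

Set Implicit Arguments.
Unset Strict Implicit.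
Unset Printing Implicit Defensive.

Import Order.TTheory GRing.Theory Num.Theory.
Import numFieldNormedType.Exports.

Local Open Scope classical_set_scope.
Local Open Scope ring_scope.

Section MinkowskiSpacetime.
Variable R : realType.

(* Points, tangent vectors and covectors of R^{3,1} are all given by their
   components with respect to x^0, ..., x^3. *)
Definition eta_sign (mu : 'I_4) : R := if mu == ord0 then -1 else 1.

Definition mink (X Y : 'rV[R]_4) : R :=
  \sum_(mu < 4) eta_sign mu * X ord0 mu * Y ord0 mu.

(* The metric diag(-1, 1, 1, 1) is its own inverse, so the metric induced on
   covectors has the same components. *)
Definition comink (alpha beta : 'rV[R]_4) : R :=
  \sum_(mu < 4) eta_sign mu * alpha ord0 mu * beta ord0 mu.

Definition pairing (alpha X : 'rV[R]_4) : R :=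
  \sum_(mu < 4) alpha ord0 mu * X ord0 mu.

Definition dx (mu : 'I_4) : 'rV[R]_4 := delta_mx ord0 mu.

Definition basis_vector (mu : 'I_4) : 'rV[R]_4 := delta_mx ord0 mu.

Definition de_sitter : set 'rV[R]_4 := [set x | mink x x = 1].

Definition wedge_form (alpha beta X Y : 'rV[R]_4) : R :=
  pairing alpha X * pairing beta Y - pairing alpha Y * pairing beta X.

Definition calD (x : 'rV[R]_4) : 'rV[R]_4 :=
  - x ord0 ord0 *: dx ord0 + \sum_(j < 4 | j != ord0) x ord0 j *: dx j.

Definition calL (i : 'I_4) (x : 'rV[R]_4) : 'rV[R]_4 :=
  - x ord0 ord0 *: dx i + x ord0 i *: dx ord0.

Definition Q (i : 'I_4) (x X Y : 'rV[R]_4) : R :=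
  wedge_form (calD x) (calL i x) X Y
  + 2%:R^-1 * (1 + comink (calD x) (calD x)) * wedge_form (dx ord0) (dx i) X Y.

(* (div P)_nu = D^mu P_{mu nu}; the Levi-Civita connection of the flat metric
   is the componentwise derivative. *)
Definition divergence (P : 'rV[R]_4 -> 'rV[R]_4 -> 'rV[R]_4 -> R)
    (x : 'rV[R]_4) : 'rV[R]_4 :=
  \row_(nu < 4) \sum_(mu < 4) eta_sign mu *
    'D_(basis_vector mu) (fun y => P y (basis_vector mu) (basis_vector nu)) x.

Definition xi (i : 'I_4) (x : 'rV[R]_4) : 'rV[R]_4 :=
  3%:R^-1 *: divergence (Q i) x.

End MinkowskiSpacetime.

Section CalculusOnHalfPlane.
Variable R : realType.

Definition half_plane : set (R * R) := [set u | 0 <= u.1].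

Definition coord_vector (a : 'I_2) : R * R :=
  ((a == ord0)%:R, (a == ord_max)%:R).

Fixpoint Ck_open (V : normedModType R) (k : nat) (U : set (R * R))
    (f : R * R -> V) : Prop :=
  match k with
  | 0 => {in U, continuous f}
  | k'.+1 => {in U, continuous f} /\
      forall a : 'I_2, (forall u, U u -> derivable f u (coord_vector a)) /\
        Ck_open k' U ('D_(coord_vector a) f)
  end.

Definition smooth_open (V : normedModType R) (U : set (R * R))
    (f : R * R -> V) : Prop :=
  forall k, Ck_open k U f.

(* A need not be open: f has to extend smoothly around each point of A. *)
Definition smooth_on (V : normedModType R) (A : set (R * R))
    (f : R * R -> V) : Prop :=
  forall u, A u -> exists (U : set (R * R)) (g : R * R -> V),
    [/\ open U, U u, smooth_open U g & forall v, U v -> A v -> g v = f v].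

(* The difference quotient only uses points of the half plane, so that this is
   the usual partial derivative in the interior and a one-sided one, in the
   direction transverse to the boundary, on the line u.1 = 0. *)
Definition partial (V : normedModType R) (a : 'I_2) (f : R * R -> V)
    (u : R * R) : V :=
  lim ((fun h : R => h^-1 *: (f (h *: coord_vector a + u) - f u)) @
       within [set h : R | half_plane (h *: coord_vector a + u)] 0^').

End CalculusOnHalfPlane.

Notation borel M := (g_sigma_algebraType (@open M)).

Section Surfaces.
Variable R : realType.

(* coord is meaningful on dom only, and param on the image of dom under coord. *)
Record chart (M : topologicalType) := Chart {
  dom : set M;
  coord : M -> R * R;
  param : R * R -> M }.

Definition is_chart (M : topologicalType) (c : chart M) : Prop :=
  [/\ open (dom c),
      exists2 W : set (R * R), open W &
        coord c @` dom c = W `&` @half_plane R,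
      forall p, dom c p -> param c (coord c p) = p,
      {within dom c, continuous (coord c)} &
      {within coord c @` dom c, continuous (param c)}].

Definition overlap (M : topologicalType) (c c' : chart M) : set (R * R) :=
  coord c @` (dom c `&` dom c').

Definition transition (M : topologicalType) (c c' : chart M) : R * R -> R * R :=
  coord c' \o param c.

(* Smooth surfaces with (possibly empty) boundary; the carrier is pointed because
   the Borel sigma-algebra below is only defined on pointed types. chart_at p
   gives the local coordinates in which geometric quantities at p are written:
   it is an arbitrary chart around p, on which these quantities do not depend. *)
Record surface := Surface {
  carrier :> ptopologicalType;
  atlas : set (chart carrier);
  chart_at : carrier -> chart carrier;
  surface_hausdorff : hausdorff_space carrier;
  surface_second_countable : @second_countable carrier;
  atlas_charts : forall c, atlas c -> is_chart c;
  atlas_smooth : forall c c', atlas c -> atlas c' ->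
    smooth_on (overlap c c') (transition c c');
  chart_at_atlas : forall p, atlas (chart_at p);
  chart_at_dom : forall p, dom (chart_at p) p }.

(* An orientation is given by an atlas with orientation preserving
   transitions. *)
Definition oriented (M : surface) : Prop :=
  forall c c', @atlas M c -> @atlas M c' ->
  forall u, overlap c c' u ->
    0 < (partial ord0 (transition c c') u).1
          * (partial ord_max (transition c c') u).2
        - (partial ord0 (transition c c') u).2
          * (partial ord_max (transition c c') u).1.

Definition boundary (M : surface) : set M :=
  [set p | exists c : chart M, [/\ atlas c, dom c p & (coord c p).1 = 0]].

Definition smooth (V : normedModType R) (M : surface) (f : M -> V) : Prop :=
  forall c : chart M, atlas c -> smooth_on (coord c @` dom c) (f \o param c).

(* d_a f at p, in the coordinates of the chart c. *)
Definition diff_at (V : normedModType R) (M : surface) (c : chart M)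
    (a : 'I_2) (f : M -> V) (p : M) : V :=
  partial a (f \o param c) (coord c p).

Definition diff2_at (V : normedModType R) (M : surface) (c : chart M)
    (a b : 'I_2) (f : M -> V) (p : M) : V :=
  partial a (partial b (f \o param c)) (coord c p).

(* The image of T_p M under the differential of the immersion F. *)
Definition tangent_space (M : surface) (F : M -> 'rV[R]_4) (p : M) :
    set 'rV[R]_4 :=
  [set X | exists v : 'I_2 -> R,
     X = \sum_(a < 2) v a *: diff_at (chart_at p) a F p].

Definition normal_space (M : surface) (F : M -> 'rV[R]_4) (p : M) :
    set 'rV[R]_4 :=
  [set Y | forall X, tangent_space F p X -> mink X Y = 0].

Definition immersion (M : surface) (F : M -> 'rV[R]_4) : Prop :=
  smooth F /\
  forall p (v : 'I_2 -> R),
    \sum_(a < 2) v a *: diff_at (chart_at p) a F p = 0 -> forall a, v a = 0.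

Definition spacelike (M : surface) (F : M -> 'rV[R]_4) : Prop :=
  forall p X, tangent_space F p X -> X != 0 -> 0 < mink X X.

Definition induced_metric (M : surface) (F : M -> 'rV[R]_4) (c : chart M)
    (p : M) : 'M[R]_2 :=
  \matrix_(a, b) mink (diff_at c a F p) (diff_at c b F p).

Definition induced_cometric (M : surface) (F : M -> 'rV[R]_4) (c : chart M)
    (p : M) : 'M[R]_2 :=
  invmx (induced_metric F c p).

Definition normal_proj (M : surface) (F : M -> 'rV[R]_4) (p : M)
    (Y : 'rV[R]_4) : 'rV[R]_4 :=
  let c := chart_at p in
  Y - \sum_(a < 2) \sum_(b < 2)
        (induced_cometric F c p a b * mink Y (diff_at c a F p))
          *: diff_at c b F p.

Definition mean_curvature (M : surface) (F : M -> 'rV[R]_4) (p : M) :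
    'rV[R]_4 :=
  let c := chart_at p in
  \sum_(a < 2) \sum_(b < 2)
    induced_cometric F c p a b *: normal_proj F p (diff2_at c a b F p).

(* D^a Y = g^{ab} D_{d_b} Y for a vector field Y along the immersion. *)
Definition raised_diff (M : surface) (F : M -> 'rV[R]_4) (a : 'I_2)
    (Y : M -> 'rV[R]_4) (p : M) : 'rV[R]_4 :=
  let c := chart_at p in
  \sum_(b < 2) induced_cometric F c p a b *: diff_at c b Y p.

Definition orthogonal_to_de_sitter (M : surface) (F : M -> 'rV[R]_4) : Prop :=
  forall p, @boundary M p -> tangent_space F p (F p).

Definition null_normal_field (M : surface) (F : M -> 'rV[R]_4)
    (Lb : M -> 'rV[R]_4) : Prop :=
  [/\ smooth Lb,
      forall p, normal_space F p (Lb p) &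
      forall p, mink (Lb p) (Lb p) = 0].

(* dmu = sqrt (det g) du^1 du^2 in every chart; this determines mu. *)
Definition is_area_measure (M : surface) (F : M -> 'rV[R]_4)
    (mu : {measure set (borel M) -> \bar R}) : Prop :=
  forall (c : chart M) (A : set M), atlas c ->
    measurable (A : set (borel M)) -> A `<=` dom c ->
    mu A = (\int[(@lebesgue_measure R \x @lebesgue_measure R)%E]_(u in
               coord c @` A) (Num.sqrt (\det (induced_metric F c (param c u))))%:E)%E.

Definition integrand (i : 'I_4) (M : surface) (F Lb : M -> 'rV[R]_4) (p : M) :
    R :=
  let x := F p in
  (3%:R - 1) * pairing (xi i x) (Lb p)
  + Q i x (mean_curvature F p) (Lb p)
  + \sum_(a < 2) Q i x (diff_at (chart_at p) a F p)
                   (normal_proj F p (raised_diff F a Lb p)).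

End Surfaces.

(* Main.v *)
(* The one-form V_a = Q(d_a F, L) on the surface has divergence equal to the
   integrand: Q satisfies the conformal Killing-Yano equation, whose trace over
   the tangent plane gives (n - 1) <xi, L>; differentiating d_a F gives
   Q(H, L); and the tangential part of D^a L drops out because the second
   fundamental form <D_a d_b F, L> is symmetric while Q is antisymmetric. On the
   boundary x is tangent to the surface, normal to the boundary and satisfies
   <x, x> = 1, <x, L> = 0, which forces Q(x, L) = 0, so that the flux of V
   through the boundary vanishes. In a chart this reads
   d_a (sqrt (det g) V^a) = sqrt (det g) * integrand, and since the integrand is
   linear in L, a partition of unity reduces the integral to fields L supported
   in a rectangle of a chart, where the fundamental theorem of calculus and
   Fubini's theorem apply. *)
Require Import Defs.
From mathcomp Require Import all_boot all_order all_algebra.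
From mathcomp Require Import all_classical all_reals all_analysis.
From mathcomp Require Import measurable_realfun.
From mathcomp Require Import ring lra.
(* Defs has to be imported last: vector.v also defines coord. *)
Import Defs.
Set Implicit Arguments.
Unset Strict Implicit.
Unset Printing Implicit Defensive.
Import Order.TTheory GRing.Theory Num.Theory.
Import numFieldNormedType.Exports.
Local Open Scope classical_set_scope.
Local Open Scope ring_scope.

(** * Directional derivatives *)

Section DirectionalDerivative.
Context {R : realType}.

(** Two features of the setting shape the work. [partial] is one-sided at the boundary, and a field
    read in a chart means nothing beyond the half plane. So near each point it is replaced by an
    extension to a full neighbourhood ([extends_near]), where two-sided calculus holds, and
    [partial_extends] brings the result back. Moreover the integrand at [p] is written in
    [chart_at p], an arbitrary choice not assumed to depend on [p] in any regular way. Its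
    measurability is therefore not visible from the definition; it comes from the invariance of
    [frame_density] and from the identity divergence = area density times integrand, solved for the
    integrand. The integrand contains only first derivatives of [L], so cut-off functions of class
    C^1 suffice: products of squared positive parts. The rectangles are squares in chart
    coordinates, cut at [u.1 = 0]. On a side of the square the flux vanishes because the cut-off
    does; on the side created by the cut, the boundary condition takes over. *)

Lemma derivable_line (V W : normedModType R) (f : V -> W) (u v : V) (t : R) :
  derivable (fun s : R => f (s *: v + u)) t 1 = derivable f (t *: v + u) v.
Proof.
rewrite /derivable; set g1 := fun h => h^-1 *: _; set g2 := fun h => h^-1 *: _.
suff -> : g1 = g2 by []; apply/funext => h; rewrite /g1 /g2 /=.
by rewrite addrA -scalerDl [h *: 1]mulr1.
Qed.

Lemma derive_line (V W : normedModType R) (f : V -> W) (u v : V) (t : R) :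
  'D_1 (fun s : R => f (s *: v + u)) t = 'D_v f (t *: v + u).
Proof.
rewrite /derive; set g1 := fun h => h^-1 *: _; set g2 := fun h => h^-1 *: _.
suff -> : g1 = g2 by []; apply/funext => h; rewrite /g1 /g2 /=.
by rewrite addrA -scalerDl [h *: 1]mulr1.
Qed.

Lemma continuous_line (V W : normedModType R) (f : V -> W) (u v : V) :
  derivable f u v -> (fun s : R => f (s *: v + u)) @ (0 : R) --> f u.
Proof.
move=> fuv.
have /(derivable1P f u v) := fuv.
move=> /derivable1_diffP/differentiable_continuous.
by rewrite /prop_for /continuous_at scale0r add0r.
Qed.

(** The one-variable mean value theorem along the line through [u]. Absolute values allow [t] of
    either sign, which costs two cases in the proof but keeps the later uses free of sign
    assumptions. *)
Lemma mvt_line (V : normedModType R) (f : V -> R) (u v : V) (t : R) :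
  (forall s : R, `|s| <= `|t| -> derivable f (s *: v + u) v) ->
  exists2 s : R, `|s| <= `|t| &
    f (t *: v + u) - f u = t * 'D_v f (s *: v + u).
Proof.
move=> df; pose g (s : R) := f (s *: v + u).
have dg (s : R) : `|s| <= `|t| -> is_derive s 1 g ('D_v f (s *: v + u)).
  by move=> /df dgs; apply: DeriveDef; rewrite ?derivable_line ?derive_line.
have g0 : g 0 = f u by rewrite /g scale0r add0r.
have dgo (a b : R) : (forall s : R, s \in `[a, b] -> `|s| <= `|t|) ->
    forall s, s \in `]a, b[%R -> is_derive s 1 g ('D_v f (s *: v + u)).
  by move=> ab s /subset_itv_oo_cc st; apply: dg; exact: ab.
have cg (a b : R) : (forall s : R, s \in `[a, b] -> `|s| <= `|t|) ->
    {within `[a, b], continuous g}.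
  by move=> ab; apply: derivable_within_continuous => s /ab /dg [].
rewrite -g0 -/(g t); have [t0|t0] := leP 0 t.
- have ab (s : R) : s \in `[0, t] -> `|s| <= `|t|.
    by rewrite in_itv/= => /andP[s0 st]; rewrite !ger0_norm.
  have [s s0t ->] := MVT_segment t0 (dgo _ _ ab) (cg _ _ ab).
  by exists s; [exact: ab|rewrite subr0 mulrC].
- have ab (s : R) : s \in `[t, 0] -> `|s| <= `|t|.
    by rewrite in_itv/= => /andP[ts s0]; rewrite !ler0_norm ?lerN2// ltW.
  have [s st0 E] := MVT_segment (ltW t0) (dgo _ _ ab) (cg _ _ ab).
  by exists s; [exact: ab|rewrite -opprB E sub0r mulrN opprK mulrC].
Qed.

Lemma derivable_shift_arg (V W : normedModType R) (f : V -> W) (u v c : V) :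
  derivable (fun x => f (x + c)) u v = derivable f (u + c) v.
Proof.
rewrite /derivable; set g1 := fun h => h^-1 *: _; set g2 := fun h => h^-1 *: _.
by suff -> : g1 = g2 by []; apply/funext => h; rewrite /g1 /g2 /= addrA.
Qed.

Lemma derive_shift_arg (V W : normedModType R) (f : V -> W) (u v c : V) :
  'D_v (fun x => f (x + c)) u = 'D_v f (u + c).
Proof.
rewrite /derive; set g1 := fun h => h^-1 *: _; set g2 := fun h => h^-1 *: _.
by suff -> : g1 = g2 by []; apply/funext => h; rewrite /g1 /g2 /= addrA.
Qed.

(** The mean value theorem is used twice: along [v] for [x |-> f (x + t *: w) - f x], then along [w]
    for the resulting difference of ['D_v f]. *)
Lemma second_difference (V : normedModType R) (f : V -> R) (u v w : V) (t : R) :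
  (forall s s' : R, `|s| <= `|t| -> `|s'| <= `|t| ->
    derivable f (s' *: w + (s *: v + u)) v /\
    derivable ('D_v f) (s' *: w + (s *: v + u)) w) ->
  exists s s' : R, [/\ `|s| <= `|t|, `|s'| <= `|t| &
    f (t *: w + (t *: v + u)) - f (t *: v + u) - (f (t *: w + u) - f u) =
    t * (t * 'D_w ('D_v f) (s' *: w + (s *: v + u)))].
Proof.
move=> df; pose g x := f (x + t *: w) - f x.
have [s st|s st E] := @mvt_line V g u v t.
  apply: derivableB.
    rewrite derivable_shift_arg addrC; exact: (df s t _ _).1.
  by have := (df s 0 st); rewrite normr0 scale0r add0r => /(_ (normr_ge0 _))[].
have [s' s't|s' s't E'] := @mvt_line V ('D_v f) (s *: v + u) w t.
  by exact: (df s s' _ _).2.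
exists s, s'; split => //; rewrite -E' [t *: w + _]addrC [t *: w + u]addrC.
rewrite -/(g (t *: v + u)) -/(g u) E deriveB.
- by rewrite derive_shift_arg [t *: w + _]addrC.
- rewrite derivable_shift_arg addrC; exact: (df s t _ _).1.
- by have := (df s 0 st); rewrite normr0 scale0r add0r => /(_ (normr_ge0 _))[].
Qed.

Lemma continuous_plane (V W : normedModType R) (f : V -> W) (u v w : V) :
  {for u, continuous f} ->
  (fun z : R * R => f (z.2 *: w + (z.1 *: v + u))) @ ((0, 0) : R * R) --> f u.
Proof.
move=> fu; apply: continuous_cvg => //.
rewrite -[X in _ --> X]add0r -[X in _ --> X + _](scale0r w).
apply: cvgD; first by apply: cvgZl; exact: cvg_snd.
rewrite -[X in _ --> X]add0r -[X in _ --> X + _](scale0r v).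
by apply: cvgD; [apply: cvgZl; exact: cvg_fst|exact: cvg_cst].
Qed.

Lemma ler_dist_midpoint (e A B C D : R) :
  `|A - C| <= e / 2 -> `|B - D| <= e / 2 -> C = D -> `|A - B| <= e.
Proof.
move=> AC BD CD; rewrite (splitr e) -(subrKA C).
by rewrite (le_trans (ler_normD _ _))// lerD// CD distrC.
Qed.

(** The second difference over the parallelogram spanned by [t *: v] and [t *: w] is symmetric in
    [v] and [w]. Read in either order it is [t * t] times a mixed derivative at a point near [u];
    cancelling [t * t] and using continuity brings the two mixed derivatives within [e] of each
    other. *)
Lemma schwarz (V : normedModType R) (f : V -> R) (u v w : V) :
  (\forall x \near u, derivable f x v /\ derivable ('D_v f) x w) ->
  (\forall x \near u, derivable f x w /\ derivable ('D_w f) x v) ->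
  {for u, continuous ('D_w ('D_v f))} -> {for u, continuous ('D_v ('D_w f))} ->
  'D_w ('D_v f) u = 'D_v ('D_w f) u.
Proof.
move=> dvw dwv cvw cwv; apply/eqP; rewrite -subr_eq0 -normr_le0.
apply/ler_addgt0Pl => e e0; rewrite addr0.
have e20 : 0 < e / 2 by rewrite divr_gt0.
(* A property that holds near [u] holds on all sufficiently small parallelograms based at [u]. *)
have plane (P : V -> Prop) (a b : V) : (\forall x \near u, P x) ->
    exists2 r : R, 0 < r & forall t s s' : R, `|t| < r ->
      `|s| <= `|t| -> `|s'| <= `|t| -> P (s' *: b + (s *: a + u)).
  move=> Pu; have := @continuous_plane V V id u a b (@cvg_id _ _) _ Pu.
  move=> /nbhs_ballP[r/= r0 rP]; exists r => // t s s' tr st s't.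
  apply: (rP (s, s')).
  by split; rewrite /ball/= sub0r normrN; apply: le_lt_trans tr.
have [r1 r10 N1] := plane _ v w dvw; have [r2 r20 N2] := plane _ w v dwv.
have /(plane _ v w)[r3 r30 N3] : \forall x \near u,
    `|'D_w ('D_v f) u - 'D_w ('D_v f) x| <= e / 2.
  by move/cvgrPdist_le : cvw; apply.
have /(plane _ w v)[r4 r40 N4] : \forall x \near u,
    `|'D_v ('D_w f) u - 'D_v ('D_w f) x| <= e / 2.
  by move/cvgrPdist_le : cwv; apply.
(* Two radii secure the derivability needed for the two orders, two secure [e / 2]-closeness of the
   mixed derivatives; any nonzero [t] below all four would do. *)
pose r := Num.min (Num.min r1 r2) (Num.min r3 r4).
have r0 : 0 < r by rewrite !lt_min r10 r20 r30.
pose t := r / 2; have t0 : t != 0 by rewrite gt_eqF// divr_gt0.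
have : `|t| < r by rewrite ger0_norm ?divr_ge0 ?ltW// ltr_pdivrMr// ltr_pMr// ltr1n.
rewrite !lt_min => /andP[/andP[t1 t2] /andP[t3 t4]].
have [s [s' [st s't E1]]] := second_difference (fun s s' => N1 t s s' t1).
have [q [q' [qt q't E2]]] := second_difference (fun s s' => N2 t s s' t2).
have swap (a b c d : R) : a - b - (c - d) = a - c - (b - d) by ring.
have E3 := swap (f (t *: w + (t *: v + u))) (f (t *: v + u)) (f (t *: w + u)) (f u).
rewrite {2}[t *: w + (t *: v + u)]addrCA in E3.
have /(mulfI t0)/(mulfI t0) E := etrans (esym E1) (etrans E3 E2).
exact: (ler_dist_midpoint (N3 t s s' t3 st s't) (N4 t q q' t4 qt q't) E).
Qed.

End DirectionalDerivative.

(** * Continuously differentiable functions on the plane *)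

Section C1.
Context {R : realType}.
Local Notation vec := (@coord_vector R).

(** The conditions are imposed on a whole neighbourhood, which makes the class stable under
    [near_join]. Only coordinate derivatives are required; [hadamard] recovers from them what a
    total differential would give. *)
Definition C1_near (V : normedModType R) (u : R * R) (f : R * R -> V) : Prop :=
  \forall v \near u, {for v, continuous f} /\
    forall a, derivable f v (vec a) /\ {for v, continuous ('D_(vec a) f)}.

Lemma near_eq_continuous (T U : topologicalType) (f g : T -> U) (x : T) :
  {near x, f =1 g} -> {for x, continuous f} -> {for x, continuous g}.
Proof.
move=> fg fx; rewrite /prop_for /continuous_at -(nbhs_singleton fg).
by move=> A /fx fA; apply: filterS2 fg fA => y /= ->.
Qed.

(** Lets the derivatives be supplied by a formula [df]. Since the formula is valid on a
    neighbourhood of each nearby point, the continuity of [df] passes to the actual derivative. *)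
Lemma C1_near_intro (V : normedModType R) (u : R * R) (f : R * R -> V)
    (df : 'I_2 -> R * R -> V) :
  (\forall v \near u, {for v, continuous f} /\
    forall a, is_derive v (vec a) f (df a v) /\ {for v, continuous (df a)}) ->
  C1_near u f.
Proof.
move=> /near_join; rewrite /C1_near; apply: filterS => v fdfv.
have [fv dfv] := nbhs_singleton fdfv.
split=> // a; have [[dfva _] cdf] := dfv a; split=> //.
by apply: near_eq_continuous cdf; apply: filterS fdfv => w [_ /(_ a)[[_ <-] _]].
Qed.

Lemma C1_near_cst (V : normedModType R) (u : R * R) (c : V) :
  C1_near u (cst c).
Proof.
apply: (@C1_near_intro _ _ _ (fun=> cst 0)).
apply: (@filterE _ (nbhs u) _) => v.
by split=> [|a]; [exact: cvg_cst|split; [exact: is_derive_cst|exact: cvg_cst]].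
Qed.

Lemma C1_nearD (V : normedModType R) (u : R * R) (f g : R * R -> V) :
  C1_near u f -> C1_near u g -> C1_near u (fun x => f x + g x).
Proof.
move=> fu gu.
apply: (@C1_near_intro _ _ _ (fun a x => 'D_(vec a) f x + 'D_(vec a) g x)).
apply: filterS2 fu gu => v [cf df] [cg dg].
split=> [|a]; first exact: cvgD.
have [dfa cdf] := df a; have [dga cdg] := dg a; split; last exact: cvgD.
by apply: is_deriveD; exact: derivableP.
Qed.

Lemma C1_nearN (V : normedModType R) (u : R * R) (f : R * R -> V) :
  C1_near u f -> C1_near u (fun x => - f x).
Proof.
move=> fu; apply: (@C1_near_intro _ _ _ (fun a x => - 'D_(vec a) f x)).
apply: filterS fu => v [cf df]; split=> [|a]; first exact: cvgN.
have [dfa cdf] := df a; split; last exact: cvgN.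
by apply: is_deriveN; exact: derivableP.
Qed.

Lemma C1_nearM (u : R * R) (f g : R * R -> R) :
  C1_near u f -> C1_near u g -> C1_near u (fun x => f x * g x).
Proof.
move=> fu gu.
apply: (@C1_near_intro _ _ _
  (fun a x => f x * 'D_(vec a) g x + g x * 'D_(vec a) f x)).
apply: filterS2 fu gu => v [cf df] [cg dg].
split=> [|a]; first exact: cvgM.
have [dfa cdf] := df a; have [dga cdg] := dg a; split; last first.
  exact: (cvgD (cvgM cf cdg) (cvgM cg cdf)).
exact: (is_deriveM (derivableP dfa) (derivableP dga)).
Qed.

Lemma C1_near_sum (V : normedModType R) (I : Type) (r : seq I)
    (u : R * R) (f : I -> R * R -> V) :
  (forall i, C1_near u (f i)) -> C1_near u (fun x => \sum_(i <- r) f i x).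
Proof.
move=> fu; elim: r => [|i r IH].
  by under eq_fun do rewrite big_nil; exact: C1_near_cst.
by under eq_fun do rewrite big_cons; exact: C1_nearD.
Qed.

(** Here [f] is only known to be derivable along [v], so the composition is restricted to the line
    through [u], where the one-variable chain rule applies. *)
Lemma is_derive_comp1 (V : normedModType R) (f : V -> R) (g : R -> R)
    (u v : V) (df dg : R) :
  is_derive u v f df -> is_derive (f u) 1 g dg ->
  is_derive u v (g \o f) (dg * df).
Proof.
move=> [fu fE] [gu gE].
pose l (s : R) := f (s *: v + u).
have u0 : 0 *: v + u = u by rewrite scale0r add0r.
have l0 : l 0 = f u by rewrite /l u0.
have dl : derivable l 0 1 by rewrite derivable_line u0.
have dg' : derivable g (l 0) 1 := eq_ind_r (fun x => derivable g x 1) gu l0.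
have El : 'D_1 l 0 = df by rewrite derive_line u0.
have E := derive1_comp dl dg'; rewrite !derive1E l0 gE El in E.
have Egl := derive_line (g \o f) u v 0; rewrite u0 in Egl.
apply: DeriveDef; last by rewrite -Egl; exact: E.
have := derivable_line (g \o f) u v 0; rewrite u0 => <-.
apply/derivable1_diffP; apply: (@differentiable_comp _ _ _ _ l g).
  exact: (derivable1_diffP _ _).1 dl.
exact: (derivable1_diffP _ _).1 dg'.
Qed.

Lemma C1_near_comp1 (u : R * R) (f : R * R -> R) (g dg : R -> R) :
  C1_near u f ->
  (\forall x \near f u, is_derive (x : R) (1 : R) g (dg x) /\ {for x, continuous dg}) ->
  C1_near u (fun x => g (f x)).
Proof.
move=> fu gu.
apply: (@C1_near_intro _ _ _ (fun a x => dg (f x) * 'D_(vec a) f x)).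
have cfu : {for u, continuous f} by have [] := nbhs_singleton fu.
have {}gu := cfu _ gu; apply: filterS2 fu gu => v [cf df] [dgv cdg].
split=> [|a].
  apply: (@continuous_comp _ _ _ f g) => //.
  by apply/differentiable_continuous/derivable1_diffP; case: dgv.
have [dfa cdf] := df a; split; first by apply: is_derive_comp1 => //; exact: derivableP.
by apply: cvgM => //; exact: (@continuous_comp _ _ _ f dg).
Qed.

Lemma C1_nearV (u : R * R) (f : R * R -> R) :
  f u != 0 -> C1_near u f -> C1_near u (fun x => (f x)^-1).
Proof.
move=> fu0 fu.
apply: (@C1_near_comp1 _ _ (fun x => x^-1) (fun x => - x ^- 2)) => //.
have : \forall x \near f u, x != 0 by exact: (@cvgr_neq0 _ _ _ (nbhs (f u)) _ id (f u) (@cvg_id _ _) fu0).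
apply: filterS => x x0; split.
  have dx : derivable (fun x : R => x) x 1 by exact: derivable_id.
  apply: DeriveDef; first exact: (@derivableV _ _ id).
  by rewrite (@deriveV _ _ id)// derive_id [_ *: 1]mulr1.
apply: cvgN; apply: cvgV; first by rewrite expf_neq0.
by rewrite expr2; apply: cvgM; exact: cvg_id.
Qed.

Lemma C1_near_sqrt (u : R * R) (f : R * R -> R) :
  0 < f u -> C1_near u f -> C1_near u (fun x => Num.sqrt (f x)).
Proof.
move=> fu0 fu.
apply: (@C1_near_comp1 _ _ Num.sqrt (fun x => (2 * Num.sqrt x)^-1)) => //.
have : \forall x \near f u, 0 < x by exact: (@cvgr_gt _ _ (nbhs (f u)) _ id (f u) (@cvg_id _ _) 0 fu0).
apply: filterS => x x0; split; first exact: is_derive1_sqrt.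
apply: cvgV; first by rewrite mulf_neq0// gt_eqF// sqrtr_gt0.
by apply: cvgM; [exact: cvg_cst|exact: sqrt_continuous].
Qed.

Lemma line0E (s : R) (w : R * R) : s *: vec ord0 + w = (s + w.1, w.2).
Proof. by case: w => x y; congr pair; rewrite /= ?[_ *: 1]mulr1 ?scaler0 ?add0r. Qed.

Lemma line1E (s : R) (w : R * R) : s *: vec ord_max + w = (w.1, s + w.2).
Proof. by case: w => x y; congr pair; rewrite /= ?[_ *: 1]mulr1 ?scaler0 ?add0r. Qed.

Lemma near_ball2 (u : R * R) (P : R * R -> Prop) : (\forall v \near u, P v) ->
  exists2 r : R, 0 < r & forall v : R * R, ball u r v -> P v.
Proof. by move=> uP; have [r r0 rP] := (nbhs_ballP u P).1 uP; exists r. Qed.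

(** Plays the role of total differentiability: the increment of [g] is linear in the increments of
    the coordinates, with coefficients converging to the partial derivatives. This is what the chain
    rule through a map of the plane needs. *)
Lemma hadamard (u : R * R) (g : R * R -> R) : C1_near u g ->
  exists A B : R * R -> R, [/\ A @ u --> 'D_(vec ord0) g u,
    B @ u --> 'D_(vec ord_max) g u &
    forall w, g w - g u = (w.1 - u.1) * A w + (w.2 - u.2) * B w].
Proof.
move=> gu.
(* The path from [u] to [w] turns at [(u.1, w.2)]: [B] is the slope of its vertical leg, [A] that of
   its horizontal leg. Where a leg degenerates, the limit value is put in by hand. *)
pose A (w : R * R) : R := if w.1 == u.1 then 'D_(vec ord0) g u
            else (g w - g (u.1, w.2)) / (w.1 - u.1).
pose B (w : R * R) : R := if w.2 == u.2 then 'D_(vec ord_max) g u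
            else (g (u.1, w.2) - g u) / (w.2 - u.2).
have close a (e : R) : 0 < e -> \forall v \near u, derivable g v (vec a) /\
    `|'D_(vec a) g u - 'D_(vec a) g v| <= e.
  move=> e0; have [_ /(_ a)[_ cg]] := nbhs_singleton gu.
  move/cvgrPdist_le : cg => /(_ e e0) cg; apply: filterS2 gu cg => v [_ dg] dge.
  by split=> //; have [] := dg a.
exists A, B; split.
- apply/cvgrPdist_le => e e0; have := close ord0 e e0.
  move=> /near_ball2[r r0 rP]; apply: (filterS _ (nbhsx_ballx u r r0)) => w [uw1 uw2].
  rewrite /A; case: ifPn => [_|w1]; first by rewrite subrr normr0 ltW.
  have inb (s : R) : `|s| <= `|w.1 - u.1| -> ball u r (s *: vec ord0 + (u.1, w.2)).
    move=> sw; rewrite line0E; split=> //=; rewrite /ball/= opprD addrCA subrr addr0.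
    by rewrite normrN (le_lt_trans sw)// distrC.
  have [|s sw] := @mvt_line _ _ g (u.1, w.2) (vec ord0) (w.1 - u.1).
    by move=> s sw; have [] := rP _ (inb s sw).
  rewrite {1}line0E/= subrK -surjective_pairing => ->.
  by rewrite mulrAC divff ?subr_eq0// mul1r; have [] := rP _ (inb s sw).
- apply/cvgrPdist_le => e e0; have := close ord_max e e0.
  move=> /near_ball2[r r0 rP]; apply: (filterS _ (nbhsx_ballx u r r0)) => w [uw1 uw2].
  rewrite /B; case: ifPn => [_|w2]; first by rewrite subrr normr0 ltW.
  have inb (s : R) : `|s| <= `|w.2 - u.2| -> ball u r (s *: vec ord_max + u).
    move=> sw; rewrite line1E; split=> /=; first exact: ballxx.
    rewrite /ball/= opprD addrCA subrr addr0.
    by rewrite normrN (le_lt_trans sw)// distrC.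
  have [|s sw] := @mvt_line _ _ g u (vec ord_max) (w.2 - u.2).
    by move=> s sw; have [] := rP _ (inb s sw).
  rewrite {1}line1E/= subrK => ->.
  by rewrite mulrAC divff ?subr_eq0// mul1r; have [] := rP _ (inb s sw).
- move=> w; rewrite /A /B.
  have -> : g w - g u = (g w - g (u.1, w.2)) + (g (u.1, w.2) - g u).
    by rewrite subrKA.
  congr (_ + _); case: ifPn => [/eqP E|E].
  + by rewrite -E -surjective_pairing !subrr mul0r.
  + by rewrite mulrC divfK// subr_eq0.
  + by rewrite E subrr mul0r -surjective_pairing subrr.
  + by rewrite mulrC divfK// subr_eq0.
Qed.

(** Dividing the identity of [hadamard] at [tau (h *: v + u)] by [h] leaves products of difference
    quotients of [tau], which tend to [J], with [A] and [B], which tend to the partial derivatives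
    of [g]. *)
Lemma is_derive_comp2 (g : R * R -> R) (tau : R * R -> R * R) (u v J : R * R) :
  C1_near (tau u) g -> is_derive u v tau J ->
  is_derive u v (g \o tau)
    (J.1 * 'D_(vec ord0) g (tau u) + J.2 * 'D_(vec ord_max) g (tau u)).
Proof.
move=> /hadamard[A [B [cA cB gE]]] [dtau tauE].
have ctau := continuous_line dtau.
suff H : (fun h : R => h^-1 *: (((g \o tau) \o shift u) (h *: v) - (g \o tau) u)) @ 0^'
    --> J.1 * 'D_(vec ord0) g (tau u) + J.2 * 'D_(vec ord_max) g (tau u).
  by apply: DeriveDef; [apply/cvg_ex; eexists; exact: H|exact: cvg_lim H].
have cq : (fun h : R => h^-1 *: ((tau \o shift u) (h *: v) - tau u)) @ 0^' --> J.
  by rewrite -tauE; exact: dtau.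
have q1 : (fun h : R => (h^-1 *: ((tau \o shift u) (h *: v) - tau u)).1) @ 0^' --> J.1.
  by apply: (cvg_comp _ _ cq); exact: cvg_fst.
have q2 : (fun h : R => (h^-1 *: ((tau \o shift u) (h *: v) - tau u)).2) @ 0^' --> J.2.
  by apply: (cvg_comp _ _ cq); exact: cvg_snd.
have cA' : (fun h : R => A (tau (h *: v + u))) @ 0^' --> 'D_(vec ord0) g (tau u).
  by apply: cvg_comp cA; apply: cvg_within_filter; exact: ctau.
have cB' : (fun h : R => B (tau (h *: v + u))) @ 0^' --> 'D_(vec ord_max) g (tau u).
  by apply: cvg_comp cB; apply: cvg_within_filter; exact: ctau.
set q := (X in X @ _ --> _).
suff -> : q = (fun h : R => (h^-1 *: ((tau \o shift u) (h *: v) - tau u)).1) \*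
    (fun h : R => A (tau (h *: v + u))) +
    (fun h : R => (h^-1 *: ((tau \o shift u) (h *: v) - tau u)).2) \*
    (fun h : R => B (tau (h *: v + u))).
  exact: cvgD (cvgM q1 cA') (cvgM q2 cB').
apply/funext => h; rewrite /q /= gE [LHS]mulrDr !mulrA; reflexivity.
Qed.

Lemma is_derive_fst (u v J : R * R) (tau : R * R -> R * R) :
  is_derive u v tau J -> is_derive u v (fun x => (tau x).1) J.1.
Proof.
move=> [dtau tauE].
have cq : (fun h : R => h^-1 *: ((tau \o shift u) (h *: v) - tau u)) @ 0^' --> J.
  by rewrite -tauE; exact: dtau.
have H : (fun h : R => (h^-1 *: ((tau \o shift u) (h *: v) - tau u)).1) @ 0^' --> J.1.
  by apply: (cvg_comp _ _ cq); exact: cvg_fst.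
by apply: DeriveDef; [apply/cvg_ex; eexists; exact: H|exact: cvg_lim H].
Qed.

Lemma is_derive_snd (u v J : R * R) (tau : R * R -> R * R) :
  is_derive u v tau J -> is_derive u v (fun x => (tau x).2) J.2.
Proof.
move=> [dtau tauE].
have cq : (fun h : R => h^-1 *: ((tau \o shift u) (h *: v) - tau u)) @ 0^' --> J.
  by rewrite -tauE; exact: dtau.
have H : (fun h : R => (h^-1 *: ((tau \o shift u) (h *: v) - tau u)).2) @ 0^' --> J.2.
  by apply: (cvg_comp _ _ cq); exact: cvg_snd.
by apply: DeriveDef; [apply/cvg_ex; eexists; exact: H|exact: cvg_lim H].
Qed.

Lemma C1_near_comp2 (u : R * R) (g : R * R -> R) (tau : R * R -> R * R) :
  C1_near u tau -> C1_near (tau u) g -> C1_near u (fun x => g (tau x)).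
Proof.
move=> tauu /near_join gu.
apply: (@C1_near_intro _ _ _ (fun a x =>
  ('D_(vec a) tau x).1 * 'D_(vec ord0) g (tau x)
  + ('D_(vec a) tau x).2 * 'D_(vec ord_max) g (tau x))).
have ctau : {for u, continuous tau} by have [] := nbhs_singleton tauu.
have {}gu := ctau _ gu; apply: filterS2 tauu gu => v [ct dt] gv.
have [cg dg] := nbhs_singleton (gv : \forall y \near tau v, _).
split=> [|a]; first exact: (@continuous_comp _ _ _ tau g).
have [dta cdt] := dt a; split.
  exact: is_derive_comp2 (derivableP dta).
have c1 : (fun x => ('D_(vec a) tau x).1) @ v --> ('D_(vec a) tau v).1.
  by apply: (cvg_comp _ _ cdt); exact: cvg_fst.
have c2 : (fun x => ('D_(vec a) tau x).2) @ v --> ('D_(vec a) tau v).2.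
  by apply: (cvg_comp _ _ cdt); exact: cvg_snd.
have g1 : (fun x => 'D_(vec ord0) g (tau x)) @ v --> 'D_(vec ord0) g (tau v).
  exact: (@continuous_comp _ _ _ tau _ v ct (dg ord0).2).
have g2 : (fun x => 'D_(vec ord_max) g (tau x)) @ v --> 'D_(vec ord_max) g (tau v).
  exact: (@continuous_comp _ _ _ tau _ v ct (dg ord_max).2).
exact: (cvgD (cvgM c1 g1) (cvgM c2 g2)).
Qed.

Lemma is_derive_rV n (V : normedModType R) (u v : V) (f : V -> 'rV[R]_n)
    (df : 'rV[R]_n) :
  (forall j, is_derive u v (fun x => f x ord0 j) (df ord0 j)) <->
  is_derive u v f df.
Proof.
split=> [fj|[dfu <-] j].
- have dfu : derivable f u v.
    by apply/derivable_mxP => i j; rewrite ord1; have [] := fj j.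
  apply: DeriveDef => //; rewrite derive_mx//; apply/rowP => j; rewrite mxE.
  by have [_ ->] := fj j.
- apply: DeriveDef; last by rewrite derive_mx// mxE.
  exact: (derivable_mxP _ _ _).1.
Qed.

Lemma C1_near_rV n (u : R * R) (f : R * R -> 'rV[R]_n) :
  C1_near u f -> forall j, C1_near u (fun x => f x ord0 j).
Proof.
move=> fu j; apply: (@C1_near_intro _ _ _ (fun a x => 'D_(vec a) f x ord0 j)).
apply: filterS fu => v [cf df]; split=> [|a].
  exact: (@continuous_comp _ _ _ f (fun x : 'rV[R]_n => x ord0 j) v cf (@coord_continuous _ _ _ _ _ _)).
have [dfa cdf] := df a; split.
  by move: j; apply/is_derive_rV; exact: derivableP.
exact: (@continuous_comp _ _ _ _ (fun x : 'rV[R]_n => x ord0 j) v cdf (@coord_continuous _ _ _ _ _ _)).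
Qed.

Lemma is_derive_comp_rV n (g : R * R -> 'rV[R]_n) (tau : R * R -> R * R)
    (u v J : R * R) :
  C1_near (tau u) g -> is_derive u v tau J ->
  is_derive u v (g \o tau)
    (J.1 *: 'D_(vec ord0) g (tau u) + J.2 *: 'D_(vec ord_max) g (tau u)).
Proof.
move=> gu dtau; apply/is_derive_rV => j.
have E (a b : R) (A B : 'rV[R]_n) :
    (a *: A + b *: B) ord0 j = a * A ord0 j + b * B ord0 j by rewrite !mxE.
rewrite E.
have [_ dg] := nbhs_singleton gu.
have D a := (is_derive_rV _ _ _ _).2 (derivableP (dg a).1) j.
have := is_derive_comp2 (C1_near_rV gu j) dtau.
by have [_ ->] := D ord0; have [_ ->] := D ord_max.
Qed.

End C1.

(** * Partial derivatives on the half plane *)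

Section HalfPlane.
Context {R : realType}.
Local Notation vec := (@coord_vector R).
Local Notation half_plane := (@half_plane R).

(** [f] is typically a field composed with [param c], whose values off the half plane are junk; [g]
    is a function with honest derivatives in all directions at [u], even when [u] lies on the
    boundary line. *)
Definition extends_near (V : Type) (u : R * R) (f g : R * R -> V) : Prop :=
  \forall v \near u, half_plane v -> f v = g v.

Lemma half_plane_line (a : 'I_2) (u : R * R) (h : R) :
  half_plane u -> 0 <= h -> half_plane (h *: vec a + u).
Proof.
by move=> u0 h0; rewrite /half_plane/= addr_ge0// mulr_ge0//; case: (a == _).
Qed.

(** The difference quotients of [f] and [g] agree along the steps that stay in the half plane, and
    these steps form a proper filter, so the two-sided limit for [g] is also the limit defining
    [partial]. *)
Lemma partial_extends (V : normedModType R) (a : 'I_2) (u : R * R)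
    (f g : R * R -> V) :
  half_plane u -> extends_near u f g -> derivable g u (vec a) ->
  partial a f u = 'D_(vec a) g u.
Proof.
move=> u0 fg dg; rewrite /partial.
pose A : set R := [set h : R | half_plane (h *: vec a + u)].
(* Small positive steps never leave the half plane, so every set of the filter contains one, here
   [e / 2]. *)
have pA : ProperFilter (within A 0^').
  apply: Build_ProperFilter_ex => P /= [e/= e0 eP].
  have e20 : 0 < e / 2 by rewrite divr_gt0.
  exists (e / 2); apply: eP.
  - by rewrite /ball_/= sub0r normrN gtr0_norm// ltr_pdivrMr// ltr_pMr// ltr1n.
  - by rewrite /= gt_eqF.
  - by apply: half_plane_line => //; exact: ltW.
apply: cvg_lim; first exact: norm_hausdorff.
have cg : (fun h : R => h^-1 *: ((g \o shift u) (h *: vec a) - g u)) @ within A 0^'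
    --> 'D_(vec a) g u by apply: cvg_within_filter; exact: dg.
apply: cvg_trans cg; apply: near_eq_cvg.
have : \forall h \near (0:R), half_plane (h *: vec a + u) ->
    f (h *: vec a + u) = g (h *: vec a + u).
  have dgid := continuous_line (@derivable_id R _ u (vec a)).
  exact: dgid _ fg.
move=> fgl; apply: nbhs_dnbhs; apply: filterS fgl => h fgh /fgh /= ->.
by rewrite (nbhs_singleton fg).
Qed.

(** The agreement of [f] and [g] near [u] is also an agreement near each nearby point. Hence
    extensions can be differentiated repeatedly, as the second derivatives [diff2_at] require. *)
Lemma extends_near_partial (V : normedModType R) (a : 'I_2) (u : R * R)
    (f g : R * R -> V) :
  extends_near u f g -> C1_near u g ->
  extends_near u (partial a f) ('D_(vec a) g).
Proof.
move=> /near_join fg gu; apply: filterS2 fg gu => v fg [_ dg] v0.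
by apply: partial_extends => //; have [] := dg a.
Qed.

Lemma extends_near_comp (V W : Type) (u : R * R) (f g : R * R -> V)
    (k : V -> W) : extends_near u f g -> extends_near u (k \o f) (k \o g).
Proof. by apply: filterS => v fg /fg /= ->. Qed.

End HalfPlane.

(** * Smooth maps on open sets and the symmetry of their second derivatives *)

Section Smooth.
Context {R : realType}.
Local Notation vec := (@coord_vector R).
Local Notation half_plane := (@half_plane R).

Lemma Ck_open_C1_near (V : normedModType R) (U : set (R * R))
    (f : R * R -> V) (u : R * R) :
  open U -> U u -> Ck_open 1 U f -> C1_near u f.
Proof.
move=> oU Uu [cf df]; rewrite /C1_near.
have : \forall v \near u, U v by exact: open_nbhs_nbhs.
apply: filterS => v Uv; split; first by apply: cf; rewrite inE.
by move=> a; have [dfa cdf] := df a; split; [exact: dfa|apply: cdf; rewrite inE].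
Qed.

Lemma smooth_open_derive (V : normedModType R) (U : set (R * R))
    (f : R * R -> V) (a : 'I_2) :
  smooth_open U f -> smooth_open U ('D_(vec a) f).
Proof. by move=> sf k; have [_ /(_ a)[]] := sf k.+1. Qed.

Lemma smooth_open_C1_near (V : normedModType R) (U : set (R * R))
    (f : R * R -> V) (u : R * R) :
  open U -> U u -> smooth_open U f -> C1_near u f.
Proof. by move=> oU Uu sf; apply: Ck_open_C1_near (sf 1%N). Qed.

Lemma smooth_open_schwarz n (U : set (R * R)) (f : R * R -> 'rV[R]_n)
    (u : R * R) (a b : 'I_2) :
  open U -> U u -> smooth_open U f ->
  'D_(vec a) ('D_(vec b) f) u = 'D_(vec b) ('D_(vec a) f) u.
Proof.
move=> oU Uu sf.
have U1 v : U v -> C1_near v f by move=> Uv; exact: smooth_open_C1_near sf.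
have U2 d v : U v -> C1_near v ('D_(vec d) f).
  by move=> Uv; apply: smooth_open_C1_near (smooth_open_derive d sf).
have nU : \forall v \near u, U v by exact: open_nbhs_nbhs.
have D1 d j v : U v -> is_derive v (vec d) (fun x => f x ord0 j) ('D_(vec d) f v ord0 j).
  move=> /U1/nbhs_singleton[_ /(_ d)[dfv _]].
  by move: j; apply/is_derive_rV; exact: derivableP.
have D2 d e j v : U v ->
    is_derive v (vec e) ('D_(vec d) (fun x => f x ord0 j))
      ('D_(vec e) ('D_(vec d) f) v ord0 j).
  move=> Uv.
  apply: (@near_eq_is_derive _ _ _ (fun x => 'D_(vec d) f x ord0 j)).
    have : \forall w \near v, U w by exact: open_nbhs_nbhs.
    by apply: filterS => w /(D1 d j)[_ ->].
  move: j; apply/is_derive_rV; apply: derivableP.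
  by have [_ /(_ e)[]] := nbhs_singleton (U2 d v Uv).
have C2 d e j : {for u, continuous ('D_(vec e) ('D_(vec d) (fun x => f x ord0 j)))}.
  apply: (@near_eq_continuous _ _ (fun x => 'D_(vec e) ('D_(vec d) f) x ord0 j)).
    by apply: filterS nU => w /(D2 d e j)[_ ->].
  have [_ /(_ e)[_ cdf]] := nbhs_singleton (U2 d u Uu).
  exact: (@continuous_comp _ _ _ _ (fun x : 'rV[R]_n => x ord0 j) _ cdf
           (@coord_continuous _ _ _ _ _ _)).
apply/rowP => j.
have [_ E1] := D2 b a j u Uu; have [_ E2] := D2 a b j u Uu.
refine (etrans (esym E1) (etrans _ E2)); apply: schwarz.
- by apply: filterS nU => v Uv; split; [case: (D1 b j v Uv)|case: (D2 b a j v Uv)].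
- by apply: filterS nU => v Uv; split; [case: (D1 a j v Uv)|case: (D2 a b j v Uv)].
- exact: C2.
- exact: C2.
Qed.

End Smooth.

(** * Charts *)

Lemma sum_I2 (V : nmodType) (f : 'I_2 -> V) :
  \sum_(a < 2) f a = f ord0 + f ord_max.
Proof. by rewrite big_ord_recl big_ord1; congr (_ + f _); apply/val_inj. Qed.

Section Charts.
Context {R : realType} {M : surface R}.
Local Notation vec := (@coord_vector R).
Local Notation half_plane := (@half_plane R).
Implicit Types (c : chart R M) (p : M).

Lemma half_plane_coord c p : atlas c -> dom c p -> half_plane (coord c p).
Proof.
move=> /atlas_charts[_ [W _ E] _ _ _] cp.
have : (coord c @` dom c) (coord c p) by exists p.
by rewrite E => -[].
Qed.

Lemma coord_image_near c p : atlas c -> dom c p ->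
  \forall v \near coord c p, half_plane v -> (coord c @` dom c) v.
Proof.
move=> /atlas_charts[_ [W oW E] _ _ _] cp.
have : (coord c @` dom c) (coord c p) by exists p.
rewrite E => -[Wu _].
have : \forall v \near coord c p, W v by exact: open_nbhs_nbhs.
by apply: filterS => v Wv v0.
Qed.

(** The bridge from the surface to the plane: by continuity of [param c], a property valid on an
    open set around [p] can be used at every point of the half plane close to [coord c p]. *)
Lemma param_near c p (A : set M) : atlas c -> dom c p -> open A -> A p ->
  \forall v \near coord c p, half_plane v ->
    exists q, [/\ dom c q, A q, coord c q = v & param c v = q].
Proof.
move=> ac cp oA Ap; have Dn := coord_image_near ac cp.
have [_ _ pK _ cparam] := atlas_charts ac.
have Du : (coord c @` dom c) (coord c p) by exists p.
have : \forall v \near coord c p, (coord c @` dom c) v -> A (param c v).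
  have nA : nbhs (param c (coord c p)) A.
    by rewrite pK//; exact: open_nbhs_nbhs.
  exact: ((subspace_continuousP _ _).1 cparam (coord c p) Du A nA).
apply: filterS2 Dn => v Dv DA v0; have [q cq E] := Dv v0.
have Eq : param c v = q by rewrite -E pK.
by exists q; split=> //; rewrite -Eq; apply: DA; exists q.
Qed.

(** Regularity at one point in one chart, weaker than [smooth], because fields multiplied by the
    cut-off functions below are only of class C^1. *)
Definition C1_at (V : normedModType R) c (f : M -> V) p : Prop :=
  exists2 g, C1_near (coord c p) g & extends_near (coord c p) (f \o param c) g.

Lemma smooth_extends (V : normedModType R) (f : M -> V) c p :
  smooth f -> atlas c -> dom c p ->
  exists U g, [/\ open U, U (coord c p), smooth_open U g &
    extends_near (coord c p) (f \o param c) g].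
Proof.
move=> sf ac cp; have Du : (coord c @` dom c) (coord c p) by exists p.
have [U [g [oU Uu sg gf]]] := sf c ac _ Du.
exists U, g; split=> //.
have nU : \forall v \near coord c p, U v by exact: open_nbhs_nbhs.
apply: filterS2 nU (coord_image_near ac cp) => v Uv Dv v0.
by rewrite -gf//; exact: Dv.
Qed.

Lemma smooth_C1_at (V : normedModType R) (f : M -> V) c p :
  smooth f -> atlas c -> dom c p -> C1_at c f p.
Proof.
move=> sf ac cp; have [U [g [oU Uu sg gf]]] := smooth_extends sf ac cp.
by exists g => //; exact: smooth_open_C1_near sg.
Qed.

Lemma diff_at_extends (V : normedModType R) (f : M -> V) c p g a :
  atlas c -> dom c p -> C1_near (coord c p) g ->
  extends_near (coord c p) (f \o param c) g ->
  diff_at c a f p = 'D_(vec a) g (coord c p).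
Proof.
move=> ac cp /nbhs_singleton[_ /(_ a)[dg _]] fg.
by apply: partial_extends => //; exact: half_plane_coord.
Qed.

Lemma transition_extends c c' p : atlas c -> atlas c' -> dom c p -> dom c' p ->
  exists U tau, [/\ open U, U (coord c p), smooth_open U tau,
    extends_near (coord c p) (transition c c') tau &
    tau (coord c p) = coord c' p].
Proof.
move=> ac ac' cp c'p.
have Ou : overlap c c' (coord c p) by exists p.
have [U [tau [oU Uu st tE]]] := atlas_smooth ac ac' Ou.
have [_ _ pK _ _] := atlas_charts ac.
exists U, tau; split=> //; last by rewrite tE// /transition/= pK.
have nU : \forall v \near coord c p, U v by exact: open_nbhs_nbhs.
have [oc' _ _ _ _] := atlas_charts ac'.
apply: filterS2 nU (param_near ac cp oc' c'p) => v Uv Nv v0.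
have [q [cq c'q qv vq]] := Nv v0.
by rewrite tE//; exists q.
Qed.

(** Off the half plane [g \o tau] is unconstrained. For [v] in the half plane near [coord c p], [v]
    is the coordinate of a point [q] lying in both charts, and [tau v = coord c' q] is again in the
    half plane, where [g] represents [f]. *)
Lemma extends_near_transition (V : Type) (f : M -> V) c c' p tau g :
  atlas c -> atlas c' -> dom c p -> dom c' p ->
  {for coord c p, continuous tau} -> tau (coord c p) = coord c' p ->
  extends_near (coord c p) (transition c c') tau ->
  extends_near (coord c' p) (f \o param c') g ->
  extends_near (coord c p) (f \o param c) (g \o tau).
Proof.
move=> ac ac' cp c'p ctau tE etau eg.
have [oc' _ pK' _ _] := atlas_charts ac'.
have [_ _ pK _ _] := atlas_charts ac.
rewrite -tE in eg; have {}eg := ctau _ eg.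
have {}eg : \forall v \near coord c p, half_plane (tau v) ->
    (f \o param c') (tau v) = g (tau v) by [].
rewrite /extends_near in etau *.
apply: filterS3 eg etau (param_near ac cp oc' c'p) => v gv tv Nv v0.
have [q [cq c'q qv vq]] := Nv v0.
have Ev : tau v = coord c' q by rewrite -tv// /transition/= vq.
by rewrite /= -gv Ev/=; [rewrite pK' ?vq|exact: half_plane_coord].
Qed.

(** Rows are indexed by the direction of differentiation and columns by the component of the
    transition, so that the frames transform as [F = J F'] without a transpose. *)
Definition jacobian c c' p : 'M[R]_2 :=
  \matrix_(a, b) let d := partial a (transition c c') (coord c p) in
                 if b == ord0 then d.1 else d.2.

Lemma jacobian0 c c' p a :
  jacobian c c' p a ord0 = (partial a (transition c c') (coord c p)).1.
Proof. by rewrite mxE. Qed.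

Lemma jacobian1 c c' p a :
  jacobian c c' p a ord_max = (partial a (transition c c') (coord c p)).2.
Proof. by rewrite mxE. Qed.

Lemma diff_at_jacobian n (f : M -> 'rV[R]_n) c c' p a :
  atlas c -> atlas c' -> dom c p -> dom c' p -> C1_at c' f p ->
  diff_at c a f p = \sum_(b < 2) jacobian c c' p a b *: diff_at c' b f p.
Proof.
move=> ac ac' cp c'p [g gu fg].
have [U [tau [oU Uu st etau tE]]] := transition_extends ac ac' cp c'p.
have tu := smooth_open_C1_near oU Uu st.
have [ct dt] := nbhs_singleton tu.
have fgt := extends_near_transition ac ac' cp c'p ct tE etau fg.
have u0 := half_plane_coord ac cp.
have E3 e := diff_at_extends e ac' c'p gu fg.
rewrite sum_I2 !E3 -tE jacobian0 jacobian1 (partial_extends u0 etau (dt a).1).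
rewrite -tE in gu.
have [dgt E] := is_derive_comp_rV gu (derivableP (dt a).1).
by rewrite -E; exact: partial_extends u0 fgt dgt.
Qed.

Lemma is_derive_scale n (V : normedModType R) (s : V -> R) (w : V -> 'rV[R]_n) u v ds dw :
  is_derive u v s ds -> is_derive u v w dw ->
  is_derive u v (fun x => s x *: w x) (s u *: dw + ds *: w u).
Proof.
move=> dsu dwu; apply/is_derive_rV => j.
have dwj := (is_derive_rV _ _ _ _).2 dwu j.
have E : (s u *: dw + ds *: w u) ord0 j = s u * dw ord0 j + w u ord0 j * ds.
  by rewrite !mxE [ds * _]mulrC.
rewrite E; have -> : (fun x => (s x *: w x) ord0 j) = s * (fun x => w x ord0 j).
  by apply/funext => x; rewrite mxE.
exact: (is_deriveM dsu dwj).
Qed.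

Lemma second_order_expand n (ta tb dd : R * R) (Ja Jb K : 'I_2 -> R)
    (X X' : 'I_2 -> 'I_2 -> 'rV[R]_n) (Y Y' : 'I_2 -> 'rV[R]_n) :
  (Ja ord0, Ja ord_max) = ta -> (Jb ord0, Jb ord_max) = tb ->
  (K ord0, K ord_max) = dd ->
  (forall d e, X' d e = X d e) -> (forall e, Y' e = Y e) ->
  tb.1 *: (ta.1 *: X ord0 ord0 + ta.2 *: X ord_max ord0) + dd.1 *: Y ord0
  + (tb.2 *: (ta.1 *: X ord0 ord_max + ta.2 *: X ord_max ord_max)
     + dd.2 *: Y ord_max) =
  \sum_(d < 2) \sum_(e < 2) (Ja d * Jb e) *: X' d e + \sum_(e < 2) K e *: Y' e.
Proof.
move=> <- <- <- XE YE; rewrite !sum_I2 !XE !YE /=.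
by apply/rowP => j; rewrite !mxE; ring.
Qed.

(** [K] consists of the second derivatives of the transition. It is left existential since its term
    is tangent to the surface when [f] is the immersion, hence is annihilated by the normal
    projection. *)
Lemma diff2_at_jacobian n (f : M -> 'rV[R]_n) c c' p :
  atlas c -> atlas c' -> dom c p -> dom c' p -> smooth f ->
  exists K : 'I_2 -> 'I_2 -> 'I_2 -> R, forall a b,
  diff2_at c a b f p =
    \sum_(d < 2) \sum_(e < 2)
      (jacobian c c' p a d * jacobian c c' p b e) *: diff2_at c' d e f p
    + \sum_(e < 2) K a b e *: diff_at c' e f p.
Proof.
move=> ac ac' cp c'p sf.
have [U' [g [oU' Uu' sg fg]]] := smooth_extends sf ac' c'p.
have [U [tau [oU Uu st etau tE]]] := transition_extends ac ac' cp c'p.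
have u0 := half_plane_coord ac cp; have u0' := half_plane_coord ac' c'p.
have tu := smooth_open_C1_near oU Uu st.
have gu := smooth_open_C1_near oU' Uu' sg.
have dgu e := smooth_open_C1_near oU' Uu' (smooth_open_derive e sg).
have dtu b := smooth_open_C1_near oU Uu (smooth_open_derive b st).
have [ct dt] := nbhs_singleton tu.
have fgt := extends_near_transition ac ac' cp c'p ct tE etau fg.
(* The chain rule for the first derivative, written as a function on a full neighbourhood so that it
   can be differentiated once more. *)
pose k b v := ('D_(vec b) tau v).1 *: 'D_(vec ord0) g (tau v)
              + ('D_(vec b) tau v).2 *: 'D_(vec ord_max) g (tau v).
have ek b : extends_near (coord c p) (partial b (f \o param c)) (k b).
  have gtau : \forall v \near coord c p, C1_near (tau v) g.
    have /near_join := gu; rewrite -tE => gu'; exact: ct _ gu'.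
  move/near_join : (fgt) => fgt'.
  rewrite /extends_near; apply: filterS3 fgt' gtau tu => v fgtv gv [_ dtv] v0.
  have [dgt E] := is_derive_comp_rV gv (derivableP (dtv b).1).
  by rewrite (partial_extends v0 fgtv dgt) E.
have dk a b : is_derive (coord c p) (vec a) (k b)
   (('D_(vec b) tau (coord c p)).1 *:
      (('D_(vec a) tau (coord c p)).1 *: 'D_(vec ord0) ('D_(vec ord0) g) (coord c' p) +
       ('D_(vec a) tau (coord c p)).2 *: 'D_(vec ord_max) ('D_(vec ord0) g) (coord c' p))
    + ('D_(vec a) ('D_(vec b) tau) (coord c p)).1 *: 'D_(vec ord0) g (coord c' p)
    + (('D_(vec b) tau (coord c p)).2 *:
      (('D_(vec a) tau (coord c p)).1 *: 'D_(vec ord0) ('D_(vec ord_max) g) (coord c' p) +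
       ('D_(vec a) tau (coord c p)).2 *: 'D_(vec ord_max) ('D_(vec ord_max) g) (coord c' p))
    + ('D_(vec a) ('D_(vec b) tau) (coord c p)).2 *: 'D_(vec ord_max) g (coord c' p))).
  have [_ /(_ a)[ddt _]] := nbhs_singleton (dtu b).
  rewrite -tE in dgu *.
  have dta := derivableP (dt a).1.
  apply: is_deriveD.
    exact: (is_derive_scale (is_derive_fst (derivableP ddt))
             (is_derive_comp_rV (dgu ord0) dta)).
  exact: (is_derive_scale (is_derive_snd (derivableP ddt))
             (is_derive_comp_rV (dgu ord_max) dta)).
have E1 a : partial a (transition c c') (coord c p) = 'D_(vec a) tau (coord c p).
  exact: partial_extends u0 etau (dt a).1.
have E2 d e : diff2_at c' d e f p = 'D_(vec d) ('D_(vec e) g) (coord c' p).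
  have [_ /(_ d)[dde _]] := nbhs_singleton (dgu e).
  exact: partial_extends u0' (extends_near_partial e fg gu) dde.
have E3 e : diff_at c' e f p = 'D_(vec e) g (coord c' p).
  exact: diff_at_extends.
exists (fun a b e => if e == ord0 then ('D_(vec a) ('D_(vec b) tau) (coord c p)).1
                 else ('D_(vec a) ('D_(vec b) tau) (coord c p)).2) => a b.
have [dkab E] := dk a b.
have E4 : diff2_at c a b f p = 'D_(vec a) (k b) (coord c p).
  exact: partial_extends u0 (ek b) dkab.
refine (etrans E4 (etrans E _)).
apply: (second_order_expand _ _ _ E2 E3).
- by rewrite jacobian0 jacobian1 E1 -surjective_pairing.
- by rewrite jacobian0 jacobian1 E1 -surjective_pairing.
- by rewrite /= -surjective_pairing.
Qed.

End Charts.

(** * Algebra in a tangent frame *)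

Lemma forall_I2 (P : 'I_2 -> Prop) : P ord0 -> P ord_max -> forall a, P a.
Proof.
move=> P0 P1 [[|[|//]] lta]; first by rewrite (_ : Ordinal _ = ord0)//; exact/val_inj.
by rewrite (_ : Ordinal _ = ord_max)//; exact/val_inj.
Qed.

Section MinkowskiAlgebra.
Context {R : realType}.
Implicit Types (x X Y Z : 'rV[R]_4) (k : R) (i : 'I_4).

Lemma minkC X Y : mink X Y = mink Y X.
Proof. by apply: eq_bigr => mu _; rewrite mulrAC. Qed.

Lemma minkDl X Y Z : mink (X + Y) Z = mink X Z + mink Y Z.
Proof.
by rewrite /mink -big_split; apply: eq_bigr => mu _; rewrite mxE mulrDr mulrDl.
Qed.

Lemma minkZl k X Y : mink (k *: X) Y = k * mink X Y.
Proof.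
by rewrite /mink mulr_sumr; apply: eq_bigr => mu _; rewrite mxE mulrCA !mulrA.
Qed.

Lemma minkDr X Y Z : mink X (Y + Z) = mink X Y + mink X Z.
Proof. by rewrite minkC minkDl !(minkC X). Qed.

Lemma minkZr k X Y : mink X (k *: Y) = k * mink X Y.
Proof. by rewrite minkC minkZl (minkC X). Qed.

(* dx^0 /\ dx^i *)
Definition wdg i X Y : R := X ord0 ord0 * Y ord0 i - X ord0 i * Y ord0 ord0.

Lemma wdgDl i X Y Z : wdg i (X + Y) Z = wdg i X Z + wdg i Y Z.
Proof. by rewrite /wdg !mxE; ring. Qed.

Lemma wdgZl i k X Y : wdg i (k *: X) Y = k * wdg i X Y.
Proof. by rewrite /wdg !mxE; ring. Qed.

Lemma wdgC i X Y : wdg i X Y = - wdg i Y X.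
Proof. by rewrite /wdg; ring. Qed.

Lemma pairing_dx mu X : pairing (dx R mu) X = X ord0 mu.
Proof.
rewrite /pairing (bigD1 mu)//= big1 => [|nu /negPf nm].
  by rewrite /dx mxE !eqxx mul1r addr0.
by rewrite /dx mxE nm mul0r.
Qed.

Lemma calDE x mu : calD x ord0 mu = eta_sign R mu * x ord0 mu.
Proof.
rewrite /calD /eta_sign !mxE summxE; have [->|mu0] := eqVneq mu ord0.
  rewrite eqxx !mulN1r mulr1 big1 ?addr0// => j j0.
  by rewrite !mxE eq_sym (negPf j0) mulr0.
rewrite mulr0 add0r mul1r (bigD1 mu)//= big1 => [|j /andP[_ /negPf jm]].
  by rewrite !mxE !eqxx mulr1 addr0.
by rewrite !mxE eq_sym jm mulr0.
Qed.

Lemma pairing_calD x X : pairing (calD x) X = mink x X.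
Proof. by apply: eq_bigr => mu _; rewrite calDE. Qed.

Lemma eta_sign_sq mu : eta_sign R mu * eta_sign R mu = 1.
Proof. by rewrite /eta_sign; case: ifP => _; rewrite ?mulrNN ?mulr1. Qed.

Lemma comink_calD x : comink (calD x) (calD x) = mink x x.
Proof. by apply: eq_bigr => mu _; rewrite !calDE !mulrA eta_sign_sq mul1r mulrAC mulrC mulrA. Qed.

Lemma pairing_calL i x X : pairing (calL i x) X = - wdg i x X.
Proof.
have pD al be : pairing (al + be) X = pairing al X + pairing be X.
  by rewrite /pairing -big_split; apply: eq_bigr => mu _; rewrite mxE mulrDl.
have pZ k al : pairing (k *: al) X = k * pairing al X.
  by rewrite /pairing mulr_sumr; apply: eq_bigr => mu _; rewrite mxE mulrA.
by rewrite /calL pD !pZ !pairing_dx /wdg; ring.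
Qed.

(** [calD x] is the metric dual of [x], and [calL i x] is minus the contraction of [x] into
    [dx^0 /\ dx^i]; so [Q] reduces to [mink] and [wdg], the only two forms met in later
    computations. *)
Lemma QE i x X Y : Q i x X Y =
  mink x Y * wdg i x X - mink x X * wdg i x Y
  + 2^-1 * (1 + mink x x) * wdg i X Y.
Proof.
rewrite /Q /wedge_form !pairing_calD !pairing_calL comink_calD !pairing_dx.
by rewrite /wdg; ring.
Qed.

Lemma Q_antisym i x X Y : Q i x X Y = - Q i x Y X.
Proof. by rewrite !QE [wdg i X Y]wdgC; ring. Qed.

Lemma QDl i x X Y Z : Q i x (X + Y) Z = Q i x X Z + Q i x Y Z.
Proof. by rewrite !QE !minkDr ![wdg i x (_ + _)]wdgC !wdgDl ![wdg i _ x]wdgC; ring. Qed.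

Lemma QZl i x k X Y : Q i x (k *: X) Y = k * Q i x X Y.
Proof. by rewrite !QE !minkZr ![wdg i x (_ *: _)]wdgC !wdgZl ![wdg i _ x]wdgC; ring. Qed.

Lemma QDr i x X Y Z : Q i x Z (X + Y) = Q i x Z X + Q i x Z Y.
Proof. by rewrite Q_antisym QDl opprD -!(Q_antisym _ _ Z). Qed.

Lemma QZr i x k X Y : Q i x Y (k *: X) = k * Q i x Y X.
Proof. by rewrite Q_antisym QZl -mulrN -(Q_antisym _ _ Y). Qed.

Lemma Qxx i x X : Q i x X X = 0.
Proof. by rewrite QE /wdg; ring. Qed.

(* The derivative of Q in the direction Z. *)
Definition DQ i x Z X Y : R :=
  mink Z Y * wdg i x X + mink x Y * wdg i Z X
  - (mink Z X * wdg i x Y + mink x X * wdg i Z Y) + mink x Z * wdg i X Y.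

Section Derivatives.
Context {V : normedModType R}.
Variables (u v : V) (f g : V -> 'rV[R]_4) (df dg : 'rV[R]_4).
Hypotheses (fu : is_derive u v f df) (gu : is_derive u v g dg).

Lemma is_derive_mink :
  is_derive u v (fun t => mink (f t) (g t)) (mink df (g u) + mink (f u) dg).
Proof.
have -> : (fun t => mink (f t) (g t)) =
    \sum_(mu < 4) ((fun t => eta_sign R mu * f t ord0 mu) * (fun t => g t ord0 mu)).
  by apply/funext => t; rewrite fct_sumE.
have -> : mink df (g u) + mink (f u) dg = \sum_(mu < 4)
    ((eta_sign R mu * f u ord0 mu) *: dg ord0 mu + g u ord0 mu *: (eta_sign R mu * df ord0 mu)).
  rewrite /mink -big_split; apply: eq_bigr => mu _ /=.
  by rewrite addrC; congr (_ + _); rewrite [RHS]mulrC.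
apply: is_derive_sum => mu; apply: is_deriveM; last exact: (is_derive_rV _ _ _ _).2.
exact: (@is_deriveZ _ _ _ (fun t => f t ord0 mu) _ _ _ _ ((is_derive_rV _ _ _ _).2 fu mu)).
Qed.

Lemma is_derive_wdg i :
  is_derive u v (fun t => wdg i (f t) (g t)) (wdg i df (g u) + wdg i (f u) dg).
Proof.
have fj j := (is_derive_rV _ _ _ _).2 fu j.
have gj j := (is_derive_rV _ _ _ _).2 gu j.
apply: (is_derive_eq (is_deriveB (is_deriveM (fj ord0) (gj i)) (is_deriveM (fj i) (gj ord0)))).
by rewrite /wdg /GRing.scale/=; ring.
Qed.

End Derivatives.

Lemma is_derive_Q (V : normedModType R) (u v : V) (f X Y : V -> 'rV[R]_4)
    (df dX dY : 'rV[R]_4) i :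
  is_derive u v f df -> is_derive u v X dX -> is_derive u v Y dY ->
  is_derive u v (fun t => Q i (f t) (X t) (Y t))
    (DQ i (f u) df (X u) (Y u) + Q i (f u) dX (Y u) + Q i (f u) (X u) dY).
Proof.
move=> fu Xu Yu.
have -> : (fun t => Q i (f t) (X t) (Y t)) =
  (fun t => mink (f t) (Y t)) * (fun t => wdg i (f t) (X t))
  - (fun t => mink (f t) (X t)) * (fun t => wdg i (f t) (Y t))
  + (cst 2^-1 * (cst 1 + (fun t => mink (f t) (f t)))) * (fun t => wdg i (X t) (Y t)).
  by apply/funext => t; rewrite QE.
apply: (is_derive_eq (is_deriveD (is_deriveB
  (is_deriveM (is_derive_mink fu Yu) (is_derive_wdg fu Xu i))
  (is_deriveM (is_derive_mink fu Xu) (is_derive_wdg fu Yu i)))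
  (is_deriveM (is_deriveM (is_derive_cst _ _ _)
      (is_deriveD (is_derive_cst _ _ _) (is_derive_mink fu fu)))
     (is_derive_wdg Xu Yu i)))).
rewrite /DQ !QE /GRing.scale/= [mink df (f u)]minkC.
rewrite [((fun=> 2^-1) * _) u]/GRing.mul/= [((fun=> 1) + _) u]/GRing.add/=.
by field.
Qed.

Lemma mink_basis Y mu : mink (basis_vector R mu) Y = eta_sign R mu * Y ord0 mu.
Proof.
rewrite /mink (bigD1 mu)//= big1 => [|nu /negPf nm].
  by rewrite mxE !eqxx mulr1 addr0.
by rewrite mxE nm mulr0 mul0r.
Qed.

Lemma wdg_basis i x Y :
  \sum_mu Y ord0 mu * wdg i x (basis_vector R mu) = wdg i x Y.
Proof.
transitivity (x ord0 ord0 * pairing (dx R i) Y - x ord0 i * pairing (dx R ord0) Y).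
  rewrite /pairing !mulr_sumr -sumrB; apply: eq_bigr => mu _.
  by rewrite /wdg !mxE !eqxx [i == mu]eq_sym [ord0 == mu]eq_sym /=; ring.
by rewrite !pairing_dx.
Qed.

(** In the trace of [DQ] the terms carrying [mink x Z] cancel. Each [mu] leaves
    [e_nu^mu * wdg i x e_mu - wdg i x e_nu], and the four of them add up to
    [(1 - 4) * wdg i x e_nu]; the factor 1/3 in [xi] turns this into the pairing with [calL i x]. *)
Lemma pairing_xi i x Y : pairing (xi i x) Y = - wdg i x Y.
Proof.
have dQ mu nu : 'D_(basis_vector R mu)
    (fun y => Q i y (basis_vector R mu) (basis_vector R nu)) x =
    DQ i x (basis_vector R mu) (basis_vector R mu) (basis_vector R nu).
  have := is_derive_Q i (is_derive_id x (basis_vector R mu))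
    (is_derive_cst (basis_vector R mu) x (basis_vector R mu))
    (is_derive_cst (basis_vector R nu) x (basis_vector R mu)).
  move=> [_ ->] /=; have Q0l Z : Q i x 0 Z = 0.
    by rewrite -(scale0r (0 : 'rV[R]_4)) QZl mul0r.
  by rewrite [Q i x _ 0]Q_antisym !Q0l oppr0 !addr0.
have divQ nu : divergence (Q i) x ord0 nu = - 3 * wdg i x (basis_vector R nu).
  rewrite mxE.
  transitivity (\sum_mu (basis_vector R nu ord0 mu * wdg i x (basis_vector R mu)
                         - wdg i x (basis_vector R nu))).
    apply: eq_bigr => mu _; rewrite dQ /DQ !mink_basis.
    have -> : basis_vector R mu ord0 mu = 1 by rewrite mxE !eqxx.
    have E := eta_sign_sq mu.
    have -> : wdg i (basis_vector R mu) (basis_vector R mu) = 0 by rewrite /wdg; ring.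
    transitivity (eta_sign R mu * eta_sign R mu *
      (basis_vector R nu ord0 mu * wdg i x (basis_vector R mu)
       - wdg i x (basis_vector R nu))); [ring|by rewrite E mul1r].
  rewrite big_split/= wdg_basis sumr_const card_ord.
  by rewrite -mulr_natl; ring.
rewrite -wdg_basis -sumrN; apply: eq_bigr => nu _.
by rewrite mxE divQ; field.
Qed.

Lemma det_2x2 (A : 'M[R]_2) :
  \det A = A ord0 ord0 * A ord_max ord_max - A ord0 ord_max * A ord_max ord0.
Proof.
have L0 : lift (ord0 : 'I_2) (0 : 'I_1) = ord_max by exact/val_inj.
have L1 : lift (ord_max : 'I_2) (0 : 'I_1) = ord0 by exact/val_inj.
rewrite (expand_det_row _ ord0) sum_I2 /cofactor !det_mx11 !mxE L0 L1 /=.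
by rewrite expr0 expr1; ring.
Qed.

Lemma invmx_2x2 (A : 'M[R]_2) : \det A != 0 -> invmx A =
  (\det A)^-1 *: \matrix_(a, b) (if a == b then A (rev_ord a) (rev_ord b) else - A a b).
Proof.
move=> A0; set B := (X in _ = X).
have r0 : rev_ord (ord0 : 'I_2) = ord_max by exact/val_inj.
have r1 : rev_ord (ord_max : 'I_2) = ord0 by exact/val_inj.
suff AB : A *m B = 1%:M.
  have uA : A \in unitmx by rewrite unitmxE unitfE.
  by rewrite -[B](mulKmx uA) AB mulmx1.
move: (A0); rewrite {1}det_2x2 => A0'.
apply/matrixP; apply: forall_I2; apply: forall_I2.
all: rewrite !mxE sum_I2 !mxE /= ?r0 ?r1 ?det_2x2.
all: by field.
Qed.

(** From here on the tangent frame is an arbitrary pair of vectors: geometry at a point becomes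
    linear algebra, and a change of chart becomes a change of frame. *)
Definition gram (F : 'I_2 -> 'rV[R]_4) : 'M[R]_2 :=
  \matrix_(a, b) mink (F a) (F b).

Lemma det_gram F : \det (gram F) =
  mink (F ord0) (F ord0) * mink (F ord_max) (F ord_max)
  - mink (F ord0) (F ord_max) * mink (F ord0) (F ord_max).
Proof. by rewrite det_2x2 !mxE [mink (F ord_max) (F ord0)]minkC. Qed.

Definition frame_proj (F : 'I_2 -> 'rV[R]_4) Y : 'rV[R]_4 :=
  Y - \sum_(a < 2) \sum_(b < 2) (invmx (gram F) a b * mink Y (F a)) *: F b.

(* The integrand in a frame F, where S, L and dL stand for the second
   derivatives of the immersion, for the normal field and for its derivatives. *)
Definition frame_density i x (F : 'I_2 -> 'rV[R]_4) (S : 'I_2 -> 'I_2 -> 'rV[R]_4)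
    (L : 'rV[R]_4) (dL : 'I_2 -> 'rV[R]_4) : R :=
  2 * (- wdg i x L)
  + Q i x (\sum_(a < 2) \sum_(b < 2) invmx (gram F) a b *: frame_proj F (S a b)) L
  + \sum_(a < 2) Q i x (F a) (frame_proj F (\sum_(b < 2) invmx (gram F) a b *: dL b)).

Lemma frame_proj_linear F k X Y :
  frame_proj F (k *: X + Y) = k *: frame_proj F X + frame_proj F Y.
Proof.
rewrite /frame_proj !sum_I2 !minkDl !minkZl.
move: (invmx _) => A; apply/rowP => j; rewrite !mxE; ring.
Qed.

Lemma frame_projZ F k X : frame_proj F (k *: X) = k *: frame_proj F X.
Proof.
have E0 : frame_proj F 0 = 0.
  by have := frame_proj_linear F (-1) 0 0; rewrite !scaleN1r addr0 oppr0 addNr.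
by have := frame_proj_linear F k X 0; rewrite !addr0 E0 addr0.
Qed.

Lemma frame_projD F X Y : frame_proj F (X + Y) = frame_proj F X + frame_proj F Y.
Proof. by have := frame_proj_linear F 1 X Y; rewrite !scale1r. Qed.

(** Written as a single trace against the cometric, the density exposes the two tensors whose
    invariance and additivity are used later. *)
Lemma frame_density_trace i x F S L dL : frame_density i x F S L dL =
  2 * (- wdg i x L) + \sum_(a < 2) \sum_(b < 2) invmx (gram F) a b *
    (Q i x (frame_proj F (S a b)) L + Q i x (F a) (frame_proj F (dL b))).
Proof.
rewrite /frame_density !sum_I2 !frame_projD !frame_projZ.
move: (frame_proj F) (invmx _) => P A.
rewrite !(QDl, QZl) !(QDr, QZr).
ring.
Qed.

(** The splitting into normal and tangential parts. For [Y] a second derivative of the immersion,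
    the coefficients [t] are the Christoffel symbols, and the second clause is the formula for their
    lowered form. *)
Lemma frame_decomposition F Y : \det (gram F) != 0 ->
  exists t : 'I_2 -> R,
    Y = frame_proj F Y + \sum_(b < 2) t b *: F b /\
    forall a, mink Y (F a) = \sum_(b < 2) t b * mink (F b) (F a).
Proof.
move=> G0; exists (fun b => \sum_(a < 2) invmx (gram F) a b * mink Y (F a)); split.
  rewrite /frame_proj -[LHS](subrK (\sum_(a < 2) \sum_(b < 2)
    (invmx (gram F) a b * mink Y (F a)) *: F b)); congr (_ + _).
  by rewrite exchange_big; apply: eq_bigr => b _; rewrite scaler_suml.
have E c a : \sum_(b < 2) invmx (gram F) c b * mink (F b) (F a) = (c == a)%:R.
  have uG : gram F \in unitmx by rewrite unitmxE unitfE.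
  have /matrixP/(_ c a) := mulVmx uG; rewrite !mxE => <-.
  by apply: eq_bigr => b _; rewrite mxE.
move=> a; transitivity (\sum_(c < 2) mink Y (F c) * (c == a)%:R).
  rewrite (bigD1 a)//= eqxx mulr1 big1 ?addr0// => c /negPf ->.
  by rewrite mulr0.
by under eq_bigr do rewrite -E; rewrite !sum_I2; ring.
Qed.

(** The divergence computation with all vectors replaced by scalars. [a], [b], [c] are the
    tangential coefficients of the second derivatives 00, 01, 11, and [tbc] is the coefficient of
    [F c] in [dL b]. Further, [w] is [wdg i x L], [xa] is [<x, F a>], [Wa] is [wdg i (F a) L], [y]
    is [<x, L> * wdg i (F 0) (F 1)] and [q] is [Q (F 0) (F 1)]. Finally [nab] and [mab] are [Q] of
    the normal part of [S a b] with [L], and of [F a] with the normal part of [dL b]. *)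
Lemma scalar_divergence (r g00 g01 g11 V0 V1 a0 a1 b0 b1 c0 c1
    w x0 x1 W0 W1 y q t00 t01 t10 t11 n00 n01 n11 m00 m01 m10 m11 : R) :
  g00 * g11 - g01 * g01 != 0 ->
  t00 * g01 + t01 * g11 = t10 * g00 + t11 * g01 ->
  let G := g00 * g11 - g01 * g01 in
  let d0g00 := 2 * (a0 * g00 + a1 * g01) in
  let d0g01 := a0 * g01 + a1 * g11 + (b0 * g00 + b1 * g01) in
  let d0g11 := 2 * (b0 * g01 + b1 * g11) in
  let d1g00 := 2 * (b0 * g00 + b1 * g01) in
  let d1g01 := b0 * g01 + b1 * g11 + (c0 * g00 + c1 * g01) in
  let d1g11 := 2 * (c0 * g01 + c1 * g11) in
  let d0V0 := - g00 * w + (a0 * V0 + a1 * V1 + n00) + (t01 * q + m00) in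
  let d0V1 := (- g01 * w - x1 * W0 + x0 * W1 + y)
    + (b0 * V0 + b1 * V1 + n01) + (- t00 * q + m10) in
  let d1V0 := (- g01 * w - x0 * W1 + x1 * W0 - y)
    + (b0 * V0 + b1 * V1 + n01) + (t11 * q + m01) in
  let d1V1 := - g11 * w + (c0 * V0 + c1 * V1 + n11) + (- t10 * q + m11) in
  let d0G := d0g00 * g11 + g00 * d0g11 - 2 * g01 * d0g01 in
  let d1G := d1g00 * g11 + g00 * d1g11 - 2 * g01 * d1g01 in
  (d0g11 * V0 + g11 * d0V0 - (d0g01 * V1 + g01 * d0V1)) * r
  + (g11 * V0 - g01 * V1) * (- r * d0G / (2 * G))
  + ((d1g00 * V1 + g00 * d1V1 - (d1g01 * V0 + g01 * d1V0)) * r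
  + (g00 * V1 - g01 * V0) * (- r * d1G / (2 * G))) =
  r * G * (2 * (- w) + (g11 / G * (n00 + m00) + - g01 / G * (n01 + m01)
    + (- g01 / G * (n01 + m10) + g00 / G * (n11 + m11)))).
Proof.
move=> G0 /eqP; rewrite -subr_eq0 => /eqP T /=.
(* The two sides differ exactly by [r * q] times the hypothesis: the tangential parts of the
   derivatives of [L] pair the antisymmetric [Q] with a symmetric form. *)
apply/eqP; rewrite -subr_eq0 -[X in _ == X](mulr0 (r * q)) -T; apply/eqP.
by field; rewrite G0.
Qed.

(** The left-hand side is what the product rule gives for the sum over [a] of the derivatives of
    [sqrt (det g) V^a], with [r] standing for [1 / sqrt (det g)], whose derivative is
    [- r * dG / (2 * G)], and [r * G] for [sqrt (det g)]. As [r] enters linearly, no square root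
    appears and the identity is rational. *)
Lemma frame_divergence i x F S L dL (r : R) :
  let g a b := mink (F a) (F b) in
  let dg c a b := mink (S c a) (F b) + mink (F a) (S c b) in
  let V a := Q i x (F a) L in
  let dV b a := DQ i x (F b) (F a) L + Q i x (S b a) L + Q i x (F a) (dL b) in
  let G := \det (gram F) in
  let dG c := dg c ord0 ord0 * g ord_max ord_max + g ord0 ord0 * dg c ord_max ord_max
              - 2 * g ord0 ord_max * dg c ord0 ord_max in
  G != 0 -> (forall a b, S a b = S b a) -> (forall a, mink (F a) L = 0) ->
  (forall a b, mink (S b a) L + mink (F a) (dL b) = 0) ->
  (dg ord0 ord_max ord_max * V ord0 + g ord_max ord_max * dV ord0 ord0
   - (dg ord0 ord0 ord_max * V ord_max + g ord0 ord_max * dV ord0 ord_max)) * r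
  + (g ord_max ord_max * V ord0 - g ord0 ord_max * V ord_max)
    * (- r * dG ord0 / (2 * G))
  + ((dg ord_max ord0 ord0 * V ord_max + g ord0 ord0 * dV ord_max ord_max
     - (dg ord_max ord0 ord_max * V ord0 + g ord0 ord_max * dV ord_max ord0)) * r
  + (g ord0 ord0 * V ord_max - g ord0 ord_max * V ord0)
    * (- r * dG ord_max / (2 * G)))
  = r * G * frame_density i x F S L dL.
Proof.
move=> g dg V dV G dG G0 Ssym FL FdL.
have GE : G = g ord0 ord0 * g ord_max ord_max - g ord0 ord_max * g ord0 ord_max.
  exact: det_gram.
have [Ga [Sa Sam]] := frame_decomposition (S ord0 ord0) G0.
have [Gb [Sb Sbm]] := frame_decomposition (S ord0 ord_max) G0.
have [Gc [Sc Scm]] := frame_decomposition (S ord_max ord_max) G0.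
have [t [dL0 dL0m]] := frame_decomposition (dL ord0) G0.
have [t' [dL1 dL1m]] := frame_decomposition (dL ord_max) G0.
(* By [FdL], [<F a, dL b>] is minus [<S b a, L>], the second fundamental form, which is symmetric in
   [a] and [b]. *)
have T : t ord0 * g ord0 ord_max + t ord_max * g ord_max ord_max =
         t' ord0 * g ord0 ord0 + t' ord_max * g ord0 ord_max.
  have := FdL ord_max ord0; have := FdL ord0 ord_max.
  rewrite (Ssym ord0) => /eqP; rewrite addr_eq0 => /eqP -> /eqP.
  rewrite addrC subr_eq0 => /eqP.
  rewrite minkC dL0m [RHS]minkC dL1m !sum_I2 => E.
  by rewrite [g ord0 ord_max in RHS]/g [mink (F ord0) (F ord_max) in RHS]minkC; exact: E.
have QdL a b s : dL b = frame_proj F (dL b) + \sum_(c < 2) s c *: F c ->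
    Q i x (F a) (dL b) = Q i x (F a) (frame_proj F (dL b))
      + (s ord0 * Q i x (F a) (F ord0) + s ord_max * Q i x (F a) (F ord_max)).
  by move=> E; rewrite {1}E sum_I2 !QDr !QZr.
have QS a b s : S a b = frame_proj F (S a b) + \sum_(c < 2) s c *: F c ->
    Q i x (S a b) L = Q i x (frame_proj F (S a b)) L
      + (s ord0 * V ord0 + s ord_max * V ord_max).
  by move=> E; rewrite {1}E sum_I2 !QDl !QZl.
have g10 : mink (F ord_max) (F ord0) = g ord0 ord_max by rewrite minkC.
have DQF a b : DQ i x (F b) (F a) L = mink x L * wdg i (F b) (F a)
    - (mink (F b) (F a) * wdg i x L + mink x (F a) * wdg i (F b) L)
    + mink x (F b) * wdg i (F a) L by rewrite /DQ FL mul0r add0r.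
have w0 X : wdg i X X = 0 by rewrite /wdg; ring.
have i0 : \det (gram F) != 0 by [].
have i00 : invmx (gram F) ord0 ord0 = g ord_max ord_max / G.
  rewrite invmx_2x2// !mxE eqxx mulrC; congr (mink (F _) (F _) / _); exact/val_inj.
have i01 : invmx (gram F) ord0 ord_max = - g ord0 ord_max / G.
  by rewrite invmx_2x2// !mxE /= mulrC.
have i10 : invmx (gram F) ord_max ord0 = - g ord0 ord_max / G.
  by rewrite invmx_2x2// !mxE /= mulrC g10.
have i11 : invmx (gram F) ord_max ord_max = g ord0 ord0 / G.
  rewrite invmx_2x2// !mxE eqxx mulrC; congr (mink (F _) (F _) / _); exact/val_inj.
rewrite frame_density_trace !sum_I2 i00 i01 i10 i11.
have S10 : S ord_max ord0 = S ord0 ord_max by rewrite Ssym.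
rewrite GE in G0 *.
have := scalar_divergence r (V ord0) (V ord_max) (Ga ord0) (Ga ord_max)
  (Gb ord0) (Gb ord_max) (Gc ord0) (Gc ord_max) (wdg i x L)
  (mink x (F ord0)) (mink x (F ord_max)) (wdg i (F ord0) L) (wdg i (F ord_max) L)
  (mink x L * wdg i (F ord0) (F ord_max)) (Q i x (F ord0) (F ord_max))
  (Q i x (frame_proj F (S ord0 ord0)) L) (Q i x (frame_proj F (S ord0 ord_max)) L)
  (Q i x (frame_proj F (S ord_max ord_max)) L)
  (Q i x (F ord0) (frame_proj F (dL ord0))) (Q i x (F ord0) (frame_proj F (dL ord_max)))
  (Q i x (F ord_max) (frame_proj F (dL ord0))) (Q i x (F ord_max) (frame_proj F (dL ord_max)))
  G0 T.
cbv zeta; move=> H; refine (etrans _ (etrans H _)); last by rewrite S10.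
rewrite /dG /dg /dV S10 ![mink (F _) (S _ _)]minkC.
rewrite !Sam !Sbm !Scm !sum_I2 !DQF (QS _ _ _ Sa) (QS _ _ _ Sb) (QS _ _ _ Sc).
rewrite !(QdL _ _ _ dL0) !(QdL _ _ _ dL1) !Qxx (Q_antisym i x (F ord_max) (F ord0)) !w0 (wdgC i (F ord_max) (F ord0)) !g10.
rewrite -!/(g _ _).
generalize (g ord0 ord0) (g ord0 ord_max) (g ord_max ord_max).
generalize (V ord0) (V ord_max) (Q i x (F ord0) (F ord_max)).
by move=> *; ring.
Qed.

Lemma frame_proj_frame F e : \det (gram F) != 0 -> frame_proj F (F e) = 0.
Proof.
move=> G0; have uG : gram F \in unitmx by rewrite unitmxE unitfE.
have E b : \sum_(a < 2) mink (F e) (F a) * invmx (gram F) a b = (e == b)%:R.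
  have /matrixP/(_ e b) := mulmxV uG; rewrite !mxE => <-.
  by apply: eq_bigr => a _; rewrite !mxE.
rewrite /frame_proj exchange_big /=.
under eq_bigr do (rewrite -scaler_suml; under eq_bigr do rewrite mulrC; rewrite E).
rewrite (bigD1 e)//= eqxx scale1r big1 ?addr0 ?subrr// => b /negPf.
by rewrite eq_sym => ->; rewrite scale0r.
Qed.

(** * Invariance under a change of frame *)

Section FrameChange.
Variables (F F' : 'I_2 -> 'rV[R]_4) (J : 'M[R]_2).
Hypothesis F'E : forall a, F' a = \sum_(b < 2) J a b *: F b.

Lemma gram_change : gram F' = J *m gram F *m J^T.
Proof.
apply/matrixP => a b; rewrite !mxE sum_I2 !mxE !sum_I2 !mxE !F'E !sum_I2.
by rewrite !(minkDl, minkDr, minkZl, minkZr); ring.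
Qed.

Lemma det_gram_change : \det (gram F') = \det J ^+ 2 * \det (gram F).
Proof. by rewrite gram_change !det_mulmx det_tr; ring. Qed.

Hypothesis G'0 : \det (gram F') != 0.

Lemma det_gram_neq0 : \det (gram F) != 0.
Proof. by move: G'0; rewrite det_gram_change mulf_eq0 => /norP[]. Qed.

(** Nondegeneracy of the new Gram matrix forces [J] to be invertible, as the determinant is
    [\det J ^+ 2] times the old one. Expressing the old cometric by the new one keeps the inverse of
    [J] out of the formula. *)
Lemma invmx_gram_change c d : invmx (gram F) c d =
  \sum_(a < 2) \sum_(b < 2) J a c * invmx (gram F') a b * J b d.
Proof.
have J0 : \det J != 0.
  by move: G'0; rewrite det_gram_change mulf_eq0 expf_eq0/= => /norP[].
have uJ : J^T \in unitmx by rewrite unitmxE unitfE det_tr.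
have uG : gram F \in unitmx by rewrite unitmxE unitfE det_gram_neq0.
have uG' : gram F' \in unitmx by rewrite unitmxE unitfE.
have JG : J *m gram F = gram F' *m invmx J^T by rewrite gram_change mulmxK.
have E : J^T *m invmx (gram F') *m J *m gram F = 1%:M.
  by rewrite -!mulmxA JG (mulKmx uG') mulmxV.
have -> : invmx (gram F) = J^T *m invmx (gram F') *m J.
  by rewrite -[RHS](mulmxK uG) E mul1mx.
rewrite !mxE !sum_I2 !mxE !sum_I2 !mxE; ring.
Qed.

Lemma frame_proj_change Y : frame_proj F' Y = frame_proj F Y.
Proof.
rewrite /frame_proj !sum_I2 !invmx_gram_change !sum_I2 !F'E !sum_I2.
rewrite !(minkDr, minkZr); move: (invmx _) => A.
by apply/rowP => j; rewrite !mxE; ring.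
Qed.

(** The second derivatives are tensorial up to the tangential terms [K], which the normal projection
    removes; what remains is a trace of tensors. *)
Lemma frame_density_change i x S S' L dL dL' (K : 'I_2 -> 'I_2 -> 'I_2 -> R) :
  (forall a b, S' a b = \sum_(d < 2) \sum_(e < 2) (J a d * J b e) *: S d e
                       + \sum_(e < 2) K a b e *: F e) ->
  (forall a, dL' a = \sum_(b < 2) J a b *: dL b) ->
  frame_density i x F' S' L dL' = frame_density i x F S L dL.
Proof.
move=> S'E dL'E; rewrite !frame_density_trace; congr (_ + _).
have PF e := frame_proj_frame e det_gram_neq0.
rewrite !sum_I2 !invmx_gram_change !frame_proj_change !S'E !dL'E !F'E !sum_I2.
rewrite !(frame_projD, frame_projZ, PF, scaler0, addr0).
move: (frame_proj F) (invmx _) => P A.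
by rewrite !(QDl, QZl) !(QDr, QZr); ring.
Qed.

End FrameChange.

Lemma gram_pos F :
  (forall v : 'I_2 -> R, \sum_(a < 2) v a *: F a = 0 -> forall a, v a = 0) ->
  (forall v : 'I_2 -> R, \sum_(a < 2) v a *: F a != 0 ->
     0 < mink (\sum_(a < 2) v a *: F a) (\sum_(a < 2) v a *: F a)) ->
  0 < \det (gram F).
Proof.
move=> free pos.
pose v0 (a : 'I_2) : R := (a == ord0)%:R.
have F0 : \sum_(a < 2) v0 a *: F a = F ord0.
  by rewrite sum_I2 /v0 /= scale1r scale0r addr0.
have g00 : 0 < mink (F ord0) (F ord0).
  rewrite -F0; apply: pos; apply/eqP => /free/(_ ord0)/eqP.
  by rewrite /v0 eqxx oner_eq0.
(* The combination given by one Gram-Schmidt step: it is orthogonal to [F ord0], and its square is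
   [mink (F ord0) (F ord0)] times the determinant. *)
pose v1 (a : 'I_2) : R :=
  if a == ord0 then - mink (F ord0) (F ord_max) else mink (F ord0) (F ord0).
have : 0 < mink (\sum_(a < 2) v1 a *: F a) (\sum_(a < 2) v1 a *: F a).
  apply: pos; apply/eqP => /free/(_ ord_max)/eqP.
  by rewrite /v1 /= gt_eqF.
rewrite det_2x2 !mxE !sum_I2 /v1 /= !(minkDl, minkDr, minkZl, minkZr).
rewrite [mink (F ord_max) (F ord0)]minkC.
move: (mink (F ord0) (F ord0)) g00 => a a0.
move: (mink (F ord0) (F ord_max)) (mink (F ord_max) (F ord_max)) => b d H.
by rewrite -(pmulr_rgt0 _ a0); apply: lt_le_trans H _; rewrite le_eqVlt; apply/orP; left; apply/eqP; ring.
Qed.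

(* On the boundary, x is a multiple of the conormal dual to the first
   coordinate, and Q(x, L) vanishes there. *)
Lemma flux_boundary i x F L (v : 'I_2 -> R) :
  x = \sum_(a < 2) v a *: F a -> mink x x = 1 -> mink x (F ord_max) = 0 ->
  (forall a, mink (F a) L = 0) ->
  mink (F ord_max) (F ord_max) * Q i x (F ord0) L
  - mink (F ord0) (F ord_max) * Q i x (F ord_max) L = 0.
Proof.
rewrite sum_I2 => xE xx xF FL.
have xL : mink x L = 0 by rewrite xE minkDl !minkZl !FL !mulr0 addr0.
(* For [<x, x> = 1] the coefficient [2^-1 * (1 + mink x x)] equals 1, and the two terms in
   [wdg i x L] cancel. *)
have QxL : Q i x x L = 0 by rewrite QE xL xx /wdg; field.
have E : v ord0 * mink (F ord0) (F ord_max) + v ord_max * mink (F ord_max) (F ord_max) = 0.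
  by rewrite -xF xE minkDl !minkZl.
(* Otherwise [x] would be a multiple of [F ord_max], to which it is orthogonal, against
   [<x, x> = 1]. *)
have v0 : v ord0 != 0.
  apply/eqP => v0; move: E; rewrite v0 mul0r add0r => E.
  by move/eqP: xx; rewrite xE v0 scale0r add0r minkZl minkZr E mulr0 eq_sym oner_eq0.
have QE' : v ord0 * Q i x (F ord0) L + v ord_max * Q i x (F ord_max) L = 0.
  by rewrite -QxL {4}xE QDl !QZl.
apply: (mulfI v0); rewrite mulr0.
transitivity (mink (F ord_max) (F ord_max) *
   (v ord0 * Q i x (F ord0) L + v ord_max * Q i x (F ord_max) L)
   - (v ord0 * mink (F ord0) (F ord_max) + v ord_max * mink (F ord_max) (F ord_max))
     * Q i x (F ord_max) L); first by ring.
by rewrite E QE' mulr0 mul0r subrr.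
Qed.

End MinkowskiAlgebra.

(** * The flux in a chart *)

Section FluxCalculus.
Context {R : realType}.
Local Notation vec := (@coord_vector R).

Lemma C1_nearMBM (u : R * R) (f g h k : R * R -> R) :
  C1_near u f -> C1_near u g -> C1_near u h -> C1_near u k ->
  C1_near u (fun v => f v * g v - h v * k v).
Proof.
move=> fu gu hu ku; exact: (C1_nearD (C1_nearM fu gu) (C1_nearN (C1_nearM hu ku))).
Qed.

Lemma C1_near_mink (u : R * R) (f g : R * R -> 'rV[R]_4) :
  C1_near u f -> C1_near u g -> C1_near u (fun v => mink (f v) (g v)).
Proof.
move=> fu gu; apply: C1_near_sum => mu; apply: C1_nearM; last exact: C1_near_rV.
by apply: C1_nearM; [exact: C1_near_cst|exact: C1_near_rV].
Qed.

Lemma C1_near_wdg i (u : R * R) (f g : R * R -> 'rV[R]_4) :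
  C1_near u f -> C1_near u g -> C1_near u (fun v => wdg i (f v) (g v)).
Proof.
move=> fu gu; apply: C1_nearD; first by apply: C1_nearM; exact: C1_near_rV.
by apply: C1_nearN; apply: C1_nearM; exact: C1_near_rV.
Qed.

Lemma C1_near_Q i (u : R * R) (x f g : R * R -> 'rV[R]_4) :
  C1_near u x -> C1_near u f -> C1_near u g ->
  C1_near u (fun v => Q i (x v) (f v) (g v)).
Proof.
move=> xu fu gu; under eq_fun do rewrite QE.
apply: C1_nearD.
  apply: C1_nearD; first by apply: C1_nearM; [exact: C1_near_mink|exact: C1_near_wdg].
  by apply: C1_nearN; apply: C1_nearM; [exact: C1_near_mink|exact: C1_near_wdg].
apply: C1_nearM; last exact: C1_near_wdg.
apply: C1_nearM; first exact: C1_near_cst.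
by apply: C1_nearD; [exact: C1_near_cst|exact: C1_near_mink].
Qed.

(** The derivative is written as a multiple of the inverse root itself, so that the root stays an
    opaque factor and later algebra is rational. *)
Lemma is_derive_inv_sqrt (V : normedModType R) (u v : V) (f : V -> R) (df : R) :
  0 < f u -> is_derive u v f df ->
  is_derive u v (fun t => (Num.sqrt (f t))^-1)
    (- (Num.sqrt (f u))^-1 * df / (2 * f u)).
Proof.
move=> f0 fu; have s0 : Num.sqrt (f u) != 0 by rewrite gt_eqF// sqrtr_gt0.
have [ds dsE] := is_derive_comp1 fu (is_derive1_sqrt f0).
apply: DeriveDef; first exact: (@derivableV _ _ (Num.sqrt \o f)).
rewrite (@deriveV _ _ (Num.sqrt \o f))// dsE /=.
have -> : 2 * f u = 2 * Num.sqrt (f u) ^+ 2 by rewrite sqr_sqrtr// ltW.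
by rewrite /GRing.scale/=; field.
Qed.

Lemma sqrt_invM (x : R) : 0 < x -> Num.sqrt x = (Num.sqrt x)^-1 * x.
Proof.
move=> x0; have s0 : Num.sqrt x != 0 by rewrite gt_eqF// sqrtr_gt0.
by rewrite -{3}(sqr_sqrtr (ltW x0)) expr2 mulrA mulVf ?mul1r.
Qed.

Lemma is_derive_flux (V : normedModType R) (u v : V) (f g h k G : V -> R)
    (df dg dh dk dG : R) :
  0 < G u -> is_derive u v f df -> is_derive u v g dg ->
  is_derive u v h dh -> is_derive u v k dk -> is_derive u v G dG ->
  is_derive u v (fun t => (f t * g t - h t * k t) * (Num.sqrt (G t))^-1)
    ((df * g u + f u * dg - (dh * k u + h u * dk)) * (Num.sqrt (G u))^-1
     + (f u * g u - h u * k u) * (- (Num.sqrt (G u))^-1 * dG / (2 * G u))).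
Proof.
move=> G0 fu gu hu ku Gu.
apply: (is_derive_eq (is_deriveM (is_deriveB (is_deriveM fu gu) (is_deriveM hu ku))
  (is_derive_inv_sqrt G0 Gu))).
rewrite /GRing.scale/= -[(f * g - h * k) u]/(f u * g u - h u * k u).
by ring.
Qed.

Lemma is_derive_det2 (V : normedModType R) (u v : V) (f g h : V -> R)
    (df dg dh : R) :
  is_derive u v f df -> is_derive u v g dg -> is_derive u v h dh ->
  is_derive u v (fun t => f t * g t - h t * h t)
    (df * g u + f u * dg - 2 * h u * dh).
Proof.
move=> fu gu hu.
apply: (is_derive_eq (is_deriveB (is_deriveM fu gu) (is_deriveM hu hu))).
by rewrite /GRing.scale/=; ring.
Qed.

End FluxCalculus.

(** * The divergence identity and the boundary condition on the surface *)

Section Surface.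
Context {R : realType}.
Local Notation vec := (@coord_vector R).
Local Notation half_plane := (@half_plane R).
Variables (i : 'I_4) (Sigma : surface R) (F : Sigma -> 'rV[R]_4).
Hypotheses (himm : immersion F) (hspace : spacelike F).

Definition frame (c : chart R Sigma) (p : Sigma) (a : 'I_2) : 'rV[R]_4 :=
  diff_at c a F p.

Lemma frame_change c c' p a : atlas c -> atlas c' -> dom c p -> dom c' p ->
  frame c p a = \sum_(b < 2) jacobian c c' p a b *: frame c' p b.
Proof.
move=> ac ac' cp c'p; apply: diff_at_jacobian => //.
exact: smooth_C1_at himm.1 _ _.
Qed.

Lemma det_gram_chart_at p : 0 < \det (gram (frame (chart_at p) p)).
Proof.
apply: gram_pos; first exact: himm.2.
by move=> v v0; apply: (hspace (p := p)) => //; exists v.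
Qed.

(** [spacelike] speaks of the frame of [chart_at p]. Passing from it to [c] multiplies the
    determinant by a square, which gives nonnegativity; the Jacobian in the opposite direction gives
    nonvanishing. *)
Lemma det_gram_chart c p : atlas c -> dom c p -> 0 < \det (gram (frame c p)).
Proof.
move=> ac cp; have G0 := det_gram_chart_at p.
have ca := chart_at_atlas p; have cd := chart_at_dom p.
rewrite lt_def; apply/andP; split.
  apply: (@det_gram_neq0 _ _ (frame (chart_at p) p) (jacobian (chart_at p) c p)).
    by move=> a; exact: frame_change.
  by rewrite gt_eqF.
rewrite (@det_gram_change _ (frame (chart_at p) p) _ (jacobian c (chart_at p) p)).
  by rewrite mulr_ge0 ?sqr_ge0// ltW.
by move=> a; exact: frame_change.
Qed.

(** Frees the integrand from the arbitrary chart [chart_at p]: near a point all computations can be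
    made in one fixed chart. *)
Lemma integrand_chart c p (L : Sigma -> 'rV[R]_4) :
  atlas c -> dom c p -> C1_at c L p ->
  integrand i F L p = frame_density i (F p) (frame c p)
    (fun a b => diff2_at c a b F p) (L p) (fun a => diff_at c a L p).
Proof.
move=> ac cp Lp; have ca := chart_at_atlas p; have cd := chart_at_dom p.
transitivity (frame_density i (F p) (frame (chart_at p) p)
    (fun a b => diff2_at (chart_at p) a b F p) (L p)
    (fun a => diff_at (chart_at p) a L p)).
  rewrite /integrand /frame_density pairing_xi; congr (_ * _ + _ + _).
  by ring.
have [K SE] := diff2_at_jacobian ca ac cd cp himm.1.
apply: (@frame_density_change _ _ _ (jacobian (chart_at p) c p) _ _ _ _ _ _ _ _ _ K).
- by move=> a; exact: frame_change.
- by rewrite gt_eqF// det_gram_chart_at.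
- exact: SE.
- by move=> a; exact: diff_at_jacobian.
Qed.

(** The component [sqrt (det g) V^a]: the index is raised with the adjugate of the metric, and
    [sqrt (det g) / det g] is the inverse root. *)
Definition frame_flux (x : 'rV[R]_4) (X : 'I_2 -> 'rV[R]_4) (L : 'rV[R]_4)
    (a : 'I_2) : R :=
  let g b d := mink (X b) (X d) in
  let V b := Q i x (X b) L in
  (if a == ord0 then g ord_max ord_max * V ord0 - g ord0 ord_max * V ord_max
   else g ord0 ord0 * V ord_max - g ord0 ord_max * V ord0)
  * (Num.sqrt (\det (gram X)))^-1.

Definition flux (L : Sigma -> 'rV[R]_4) (c : chart R Sigma) (a : 'I_2)
    (u : R * R) : R :=
  let p := param c u in frame_flux (F p) (frame c p) (L p) a.

Variable L : Sigma -> 'rV[R]_4.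
Hypothesis hnorm : forall p, normal_space F p (L p).

Lemma frame_normal c p a : atlas c -> dom c p -> mink (frame c p a) (L p) = 0.
Proof.
move=> ac cp; apply: hnorm; exists (fun b => jacobian c (chart_at p) p a b).
exact: frame_change ac (chart_at_atlas p) cp (chart_at_dom p).
Qed.

(** An extension of zero may be nonzero off the half plane, but its coordinate derivatives at a
    point of the half plane are determined by values inside it. *)
Lemma derive_zero_extension (u : R * R) (f : R * R -> R) (b : 'I_2) :
  half_plane u -> extends_near u (cst 0) f -> derivable f u (vec b) ->
  'D_(vec b) f u = 0.
Proof.
move=> u0 f0 df; refine (etrans (esym (partial_extends u0 f0 df)) _).
have e0 : extends_near u (cst (0:R)) (cst 0) by exact: (@filterE _ (nbhs u)).
have dc : derivable (cst 0 : R * R -> R) u (vec b) := derivable_cst _ _ _.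
refine (etrans (partial_extends u0 e0 dc) _); exact: derive_cst.
Qed.

(** The [P a] are built from extensions of the immersion and of [L], so that the divergence can be
    taken with two-sided derivatives even at a boundary point. *)
Lemma flux_local c p : atlas c -> dom c p -> C1_at c L p ->
  exists P : 'I_2 -> R * R -> R, [/\ forall a, C1_near (coord c p) (P a),
    forall a, extends_near (coord c p) (flux L c a) (P a) &
    'D_(vec ord0) (P ord0) (coord c p) + 'D_(vec ord_max) (P ord_max) (coord c p)
      = Num.sqrt (\det (gram (frame c p))) * integrand i F L p].
Proof.
move=> ac cp Lp; have Lp' := Lp; case: Lp' => gL gLu LgL.
have [U [gF [oU Uu sgF FgF]]] := smooth_extends himm.1 ac cp.
have u0 := half_plane_coord ac cp.
have [_ _ pK _ _] := atlas_charts ac.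
have gFu := smooth_open_C1_near oU Uu sgF.
pose phi a := 'D_(vec a) gF.
have phiu a : C1_near (coord c p) (phi a).
  exact: smooth_open_C1_near oU Uu (smooth_open_derive a sgF).
have ephi a : extends_near (coord c p) (partial a (F \o param c)) (phi a).
  exact: extends_near_partial.
pose g b d v := mink (phi b v) (phi d v).
pose V b v := Q i (gF v) (phi b v) (gL v).
pose G v := g ord0 ord0 v * g ord_max ord_max v - g ord0 ord_max v * g ord0 ord_max v.
pose N (a : 'I_2) v := if a == ord0
  then g ord_max ord_max v * V ord0 v - g ord0 ord_max v * V ord_max v
  else g ord0 ord0 v * V ord_max v - g ord0 ord_max v * V ord0 v.
have frE q v a : dom c q -> coord c q = v -> frame c q a = partial a (F \o param c) v.
  by move=> cq <-.
have fr a : frame c p a = phi a (coord c p).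
  by rewrite (frE p (coord c p))//; exact: (nbhs_singleton (ephi a) u0).
have FE : F p = gF (coord c p).
  by have /= := nbhs_singleton FgF u0; rewrite pK.
have LE : L p = gL (coord c p).
  by have /= := nbhs_singleton LgL u0; rewrite pK.
have GuE : G (coord c p) = \det (gram (frame c p)) by rewrite det_gram !fr.
have Gu : 0 < G (coord c p) by rewrite GuE; exact: det_gram_chart.
have PE a : (fun v => frame_flux (gF v) (phi^~ v) (gL v) a) =
    (fun v => N a v * (Num.sqrt (G v))^-1).
  by apply/funext => v; rewrite /frame_flux det_gram.
exists (fun a v => N a v * (Num.sqrt (G v))^-1); split.
- move=> a.
  have gu b d : C1_near (coord c p) (g b d) := C1_near_mink (phiu b) (phiu d).
  have Vu b : C1_near (coord c p) (V b) := C1_near_Q i gFu (phiu b) gLu.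
  have Gc : C1_near (coord c p) G.
    exact: (C1_nearMBM (gu _ _) (gu _ _) (gu _ _) (gu _ _)).
  have Nc : C1_near (coord c p) (N a).
    rewrite /N; case: (a == ord0).
      exact: (C1_nearMBM (gu _ _) (Vu _) (gu _ _) (Vu _)).
    exact: (C1_nearMBM (gu _ _) (Vu _) (gu _ _) (Vu _)).
  have s0 : Num.sqrt (G (coord c p)) != 0 by rewrite gt_eqF// sqrtr_gt0.
  exact: (C1_nearM Nc (C1_nearV s0 (C1_near_sqrt Gu Gc))).
- move=> a; rewrite -PE; have e0 := ephi ord0; have e1 := ephi ord_max.
  have Dn := param_near ac cp openT I.
  have FgF' := FgF; have LgL' := LgL; rewrite /extends_near in e0 e1 FgF' LgL' *.
  apply: filterS3 (filterI e0 e1) (filterI FgF' LgL') Dn.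
  move=> v [e0v e1v] [Fv Lv] Dv v0.
  have [q [cq _ qv vq]] := Dv v0.
  have frq : frame c q = phi^~ v.
    apply/funext; apply: forall_I2; rewrite (frE q v)//; [exact: e0v|exact: e1v].
  have Fq : F q = gF v by rewrite -vq; exact: Fv.
  have Lq : L q = gL v by rewrite -vq; exact: Lv.
  by rewrite /flux vq frq Fq Lq.
pose S a b := 'D_(vec a) (phi b) (coord c p).
pose dL a := 'D_(vec a) gL (coord c p).
have [_ dgF] := nbhs_singleton gFu; have [_ dgL] := nbhs_singleton gLu.
have iF a := derivableP (dgF a).1; have iL a := derivableP (dgL a).1.
have iphi a b : is_derive (coord c p) (vec a) (phi b) (S a b).
  by apply: derivableP; have [_ /(_ a)[]] := nbhs_singleton (phiu b).
have ig c' b d : is_derive (coord c p) (vec c') (g b d)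
    (mink (S c' b) (phi d (coord c p)) + mink (phi b (coord c p)) (S c' d)).
  exact: is_derive_mink (iphi c' b) (iphi c' d).
have iV c' b : is_derive (coord c p) (vec c') (V b)
    (DQ i (gF (coord c p)) (phi c' (coord c p)) (phi b (coord c p)) (gL (coord c p))
     + Q i (gF (coord c p)) (S c' b) (gL (coord c p))
     + Q i (gF (coord c p)) (phi b (coord c p)) (dL c')).
  exact: is_derive_Q i (iF c') (iphi c' b) (iL c').
have Ssym a b : S a b = S b a by exact: smooth_open_schwarz sgF.
have FL a : mink (phi a (coord c p)) (gL (coord c p)) = 0.
  by rewrite -fr -LE; exact: frame_normal.
(* The relation [<F a, L> = 0] is known only inside the half plane, where the extensions represent
   the true fields; this is enough to differentiate it. *)
have FdL a b : mink (S b a) (gL (coord c p)) + mink (phi a (coord c p)) (dL b) = 0.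
  have [dm mE] := is_derive_mink (iphi b a) (iL b).
  refine (etrans (esym mE) _); apply: derive_zero_extension => //.
  have ea := ephi a; have Dn := param_near ac cp openT I.
  have LgL' := LgL; rewrite /extends_near in ea LgL' *.
  apply: filterS3 ea LgL' Dn => v ev Lv Dv v0.
  have [q [cq _ qv vq]] := Dv v0.
  rewrite -(ev v0) -(Lv v0) /= vq -(frE q v)//.
  by apply/esym; exact: frame_normal.
have iG c' := is_derive_det2 (ig c' ord0 ord0) (ig c' ord_max ord_max) (ig c' ord0 ord_max).
have [_ D0] := is_derive_flux Gu (ig ord0 ord_max ord_max) (iV ord0 ord0)
  (ig ord0 ord0 ord_max) (iV ord0 ord_max) (iG ord0).
have [_ D1] := is_derive_flux Gu (ig ord_max ord0 ord0) (iV ord_max ord_max)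
  (ig ord_max ord0 ord_max) (iV ord_max ord0) (iG ord_max).
have frphi : frame c p = phi^~ (coord c p) by apply/funext => a; exact: fr.
have GuE' : G (coord c p) = \det (gram (phi^~ (coord c p))) by rewrite GuE frphi.
have dne : \det (gram (phi^~ (coord c p))) != 0 :=
  lt0r_neq0 (eq_ind _ (fun x => 0 < x) Gu _ GuE').
have FD := frame_divergence i (gF (coord c p)) (Num.sqrt (G (coord c p)))^-1 dne Ssym FL FdL.
have E1 : integrand i F L p = frame_density i (gF (coord c p)) (phi^~ (coord c p)) S
    (gL (coord c p)) dL.
  refine (etrans (integrand_chart ac cp Lp) _).
  have -> : (fun a b => diff2_at c a b F p) = S.
    apply/funext => a; apply/funext => b.
    apply: (partial_extends u0 (ephi b)).
    by have [_ /(_ a)[]] := nbhs_singleton (phiu b).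
  have -> : (fun a => diff_at c a L p) = dL.
    by apply/funext => a; exact: (partial_extends u0 LgL (dgL a).1).
  by rewrite frphi FE LE.
have rG : Num.sqrt (\det (gram (frame c p))) =
    (Num.sqrt (G (coord c p)))^-1 * \det (gram (phi^~ (coord c p))).
  by rewrite -GuE -GuE'; exact: sqrt_invM.
refine (etrans (f_equal2 +%R D0 D1) (etrans _ (esym (f_equal2 *%R rG E1)))).
refine (etrans _ FD); rewrite GuE'; reflexivity.
Qed.

(** The flux contains no derivative of [L], so vanishing at the single point is enough. *)
Lemma flux_eq0 c a u : L (param c u) = 0 -> flux L c a u = 0.
Proof.
move=> L0; have Q0 (x X : 'rV[R]_4) : Q i x X 0 = 0.
  by rewrite -(scale0r (0 : 'rV[R]_4)) QZr mul0r.
rewrite /flux L0; move: (frame c _) (F _) => X x.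
rewrite /frame_flux !Q0 !mulr0 subrr; case: ifP => _; exact: mul0r.
Qed.

Hypothesis hbdry : forall p : Sigma, boundary p -> de_sitter (F p).
Hypothesis horth : orthogonal_to_de_sitter F.

(** The second coordinate direction is tangent to the boundary, along which [<F, F>] is constantly
    1; differentiating gives the orthogonality. *)
Lemma frame_boundary c p : atlas c -> dom c p -> (coord c p).1 = 0 ->
  mink (F p) (frame c p ord_max) = 0.
Proof.
move=> ac cp u10; have u0 := half_plane_coord ac cp.
have [_ _ pK _ _] := atlas_charts ac.
have [U [gF [oU Uu sgF FgF]]] := smooth_extends himm.1 ac cp.
have gFu := smooth_open_C1_near oU Uu sgF.
have [_ /(_ ord_max)[dgF _]] := nbhs_singleton gFu.
have FE : F p = gF (coord c p).
  by have /= := nbhs_singleton FgF u0; rewrite pK.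
have frE : frame c p ord_max = 'D_(vec ord_max) gF (coord c p).
  exact: partial_extends.
have [_ mE] := is_derive_mink (derivableP dgF) (derivableP dgF).
have D0 : 'D_(vec ord_max) (fun v => mink (gF v) (gF v)) (coord c p) = 0.
  have := derive_line (fun v => mink (gF v) (gF v)) (coord c p) (vec ord_max) 0.
  rewrite scale0r add0r => <-.
  (* The line through [coord c p] in the direction [vec ord_max] stays in [u.1 = 0], so its nearby
     points are coordinates of boundary points. *)
  have E1 : \forall s \near (0 : R), (cst 1 : R -> R) s =
      mink (gF (s *: vec ord_max + coord c p)) (gF (s *: vec ord_max + coord c p)).
    have Dn := param_near ac cp openT I.
    have FgF' := FgF; rewrite /extends_near in FgF'.
    have cl := continuous_line (@derivable_id R _ (coord c p) (vec ord_max)).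
    have clF : \forall s \near (0 : R), half_plane (s *: vec ord_max + coord c p) ->
        (F \o param c) (s *: vec ord_max + coord c p) = gF (s *: vec ord_max + coord c p).
      exact: cl _ FgF'.
    have clD : \forall s \near (0 : R), half_plane (s *: vec ord_max + coord c p) ->
        exists q, [/\ dom c q, setT q, coord c q = s *: vec ord_max + coord c p &
          param c (s *: vec ord_max + coord c p) = q].
      exact: cl _ Dn.
    apply: filterS2 clF clD => s.
    have l1 : (s *: vec ord_max + coord c p).1 = 0 by rewrite line1E.
    have l0 : half_plane (s *: vec ord_max + coord c p) by rewrite line1E /half_plane/= u10.
    move=> Fs' Ds'; have Fs := Fs' l0; have [q [cq _ qv vq]] := Ds' l0.
    have Fq : F q = gF (s *: vec ord_max + coord c p) by rewrite -vq; exact: Fs.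
    rewrite -Fq; apply/esym; apply: (hbdry (p := q)); exists c; split=> //.
    by rewrite qv.
  have [_ D1] := near_eq_is_derive E1 (is_derive_cst (1 : R) (0 : R) (1 : R)).
  exact: D1.
have : 2 * mink (F p) (frame c p ord_max) = 0.
  refine (etrans _ D0); refine (etrans _ (esym mE)); rewrite FE frE.
  by rewrite [X in _ = X + _]minkC mulr_natl mulr2n.
by move=> /eqP; rewrite mulf_eq0 pnatr_eq0/= => /eqP.
Qed.

Lemma flux_eq0_boundary c p : atlas c -> dom c p -> (coord c p).1 = 0 ->
  flux L c ord0 (coord c p) = 0.
Proof.
move=> ac cp u10; have [_ _ pK _ _] := atlas_charts ac.
have bp : boundary p by exists c.
have [v FE] := horth bp.
rewrite /flux /frame_flux pK//=.
(* Orthogonality gives coefficients of [F p] in the frame of [chart_at p]; the Jacobian converts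
   them to the frame of [c]. *)
rewrite (@flux_boundary _ i (F p) (frame c p) (L p)
  (fun b => \sum_(a < 2) v a * jacobian (chart_at p) c p a b)) ?mul0r//.
- have fE a : diff_at (chart_at p) a F p = \sum_(b < 2) jacobian (chart_at p) c p a b *: frame c p b.
    exact: frame_change (chart_at_atlas p) ac (chart_at_dom p) cp.
  rewrite [LHS]FE; under eq_bigr do rewrite fE.
  rewrite !sum_I2; move: (jacobian _ _ _) (frame c p) => J f.
  by apply/rowP => j; rewrite !mxE; ring.
- exact: hbdry.
- exact: frame_boundary.
- by move=> a; exact: frame_normal.
Qed.

End Surface.

(** * Divergence theorem on a rectangle *)

Section PlaneMeasure.
Context {R : realType}.
Local Notation lam := (@lebesgue_measure R \x @lebesgue_measure R)%E.

(* The plane with the sigma-algebra on which the product Lebesgue measure is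
   defined. *)
Local Notation plane := (measurableTypeR R * measurableTypeR R)%type.

(** The measurable sets here are those of the product sigma-algebra, so an open set has to be
    exhibited as a countable union of products: the squares of rational centre and radius that it
    contains. *)
Lemma open_measurable_plane (U : set (R * R)) :
  open U -> measurable (U : set plane).
Proof.
move=> oU.
pose box (q : rat * rat * rat) : set (R * R) :=
  `]ratr q.1.1 - ratr q.2, ratr q.1.1 + ratr q.2[ `*`
  `]ratr q.1.2 - ratr q.2, ratr q.1.2 + ratr q.2[.
have -> : U = \bigcup_q (if `[< box q `<=` U >] then box q else set0).
  apply/seteqP; split => [u Uu|u [q _]]; last first.
    by case: ifPn => // /asboolP; apply.
  have [r r0 rU] := near_ball2 (open_nbhs_nbhs (conj oU Uu)).
  have r20 : 0 < r / 2 by rewrite divr_gt0.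
  (* The half-side [q3] is below [r / 2] and the centre is within [q3] of [u] in each coordinate, so
     the square contains [u] and stays in the ball of radius [r]. *)
  have [q3] := rat_in_itvoo r20; rewrite in_itv/= => /andP[q30 q3r].
  have [q1] : exists q, ratr q \in `]u.1 - ratr q3, u.1 + ratr q3[.
    by apply: rat_in_itvoo; rewrite ltrBlDr -addrA ltrDl addr_gt0.
  rewrite in_itv/= => /andP[q11 q12].
  have [q2] : exists q, ratr q \in `]u.2 - ratr q3, u.2 + ratr q3[.
    by apply: rat_in_itvoo; rewrite ltrBlDr -addrA ltrDl addr_gt0.
  rewrite in_itv/= => /andP[q21 q22].
  exists (q1, q2, q3) => //.
  rewrite ifT; first by split; rewrite /= in_itv/=; apply/andP; split; lra.
  apply/asboolP => -[x y] [] /=; rewrite !in_itv/= => /andP[x1 x2] /andP[y1 y2].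
  by apply: rU; split; rewrite /ball/= ltr_norml; apply/andP; split; lra.
apply: countable_bigcupT_measurable => // q; case: ifP => // _.
by apply: measurableX; exact: measurable_itv.
Qed.

Lemma continuous_within_measurable (D : set (R * R)) (f : R * R -> R) :
  measurable (D : set plane) -> {within D, continuous f} ->
  measurable_fun (D : set plane) (f : plane -> R).
Proof.
move=> mD /continuousP cf; apply: (measurability _ (RGenOpens.measurableE R)).
move=> _ [_ [a [b ->] <-]].
have oab : open `]a, b[%classic by exact: interval_open.
have /open_subspaceP[V oV VD] := cf _ oab.
rewrite setIC; have := VD; rewrite /from_subspace => <-.
by apply: measurableI => //; exact: open_measurable_plane.
Qed.

Definition rectangle (a b c d : R) : set (R * R) := `[a, b] `*` `[c, d].

Lemma measurable_rectangle a b c d : measurable (rectangle a b c d : set plane).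
Proof. by apply: measurableX; exact: measurable_itv. Qed.

Lemma rectangle_integrable a b c d (k : R * R -> R) :
  {within rectangle a b c d, continuous k} ->
  lam.-integrable (rectangle a b c d : set plane) (EFin \o k).
Proof.
move=> ck; have mr := measurable_rectangle a b c d.
have mi (x y : R) : measurable (`[x, y]%classic : set (measurableTypeR R)).
  exact: measurable_itv.
have fi (x y : R) : (lebesgue_measure (`[x, y]%classic : set R) < +oo)%E.
  by rewrite lebesgue_measure_itv/=; case: ifP => _; rewrite -?EFinB ltry.
have fin : (lam (rectangle a b c d) < +oo)%E.
  have E := @product_measure1E _ _ _ _ _ (@lebesgue_measure R) (@lebesgue_measure R)
    _ _ (mi a b) (mi c d).
  rewrite [X in (X < _)%E]E; apply: lte_mul_pinfty; last exact: fi.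
    exact: measure_ge0.
  by rewrite ge0_fin_numE; [exact: fi|exact: measure_ge0].
apply: measurable_bounded_integrable => //.
  exact: continuous_within_measurable.
have cr : compact (rectangle a b c d).
  by apply: compact_setX; exact: segment_compact.
have /compact_bounded[M [_ mrt]] := continuous_compact ck cr.
by exists M; split; rewrite ?num_real // => ? ? ? ?; exact: mrt.
Qed.

Lemma patch_rectangle a b c d (k : R * R -> R) x y :
  ((EFin \o k) \_ (rectangle a b c d)) (x, y) =
  if (x \in `[a, b]) && (y \in `[c, d]) then (k (x, y))%:E else 0%E.
Proof.
rewrite patchE; case: ifPn => [|]; first by rewrite inE => -[/= -> ->].
by rewrite notin_setE => H; case: ifP => // /andP[xab ycd]; exfalso; apply: H.
Qed.

Lemma rectangle_integral_fst a b c d (k : R * R -> R) :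
  {within rectangle a b c d, continuous k} ->
  (forall y, y \in `[c, d] ->
    (\int[lebesgue_measure]_(x in `[a, b]) (k (x, y))%:E = 0)%E) ->
  (\int[lam]_(u in (rectangle a b c d : set plane)) (k u)%:E = 0)%E.
Proof.
move=> ck k0; rewrite integral_mkcond.
have /(integrable_mkcond _ (measurable_rectangle a b c d)) ik := rectangle_integrable ck.
rewrite -(integral21_prod_meas1 ik) /fubini_G.
apply: integral0_eq => y _; case: (boolP (y \in `[c, d])) => ycd.
  rewrite -(k0 y ycd) [RHS]integral_mkcond; apply: eq_integral => x _.
  by rewrite patch_rectangle ycd andbT patchE mem_setE.
by apply: integral0_eq => x _; rewrite patch_rectangle (negPf ycd) andbF.
Qed.

Lemma rectangle_integral_snd a b c d (k : R * R -> R) :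
  {within rectangle a b c d, continuous k} ->
  (forall x, x \in `[a, b] ->
    (\int[lebesgue_measure]_(y in `[c, d]) (k (x, y))%:E = 0)%E) ->
  (\int[lam]_(u in (rectangle a b c d : set plane)) (k u)%:E = 0)%E.
Proof.
move=> ck k0; rewrite integral_mkcond.
have /(integrable_mkcond _ (measurable_rectangle a b c d)) ik := rectangle_integrable ck.
rewrite -(integral12_prod_meas1 ik) /fubini_F.
apply: integral0_eq => x _; case: (boolP (x \in `[a, b])) => xab.
  rewrite -(k0 x xab) [RHS]integral_mkcond; apply: eq_integral => y _.
  by rewrite patch_rectangle xab patchE mem_setE.
by apply: integral0_eq => y _; rewrite patch_rectangle (negPf xab).
Qed.

End PlaneMeasure.

Section RectangleDivergence.
Context {R : realType}.
Local Notation vec := (@coord_vector R).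
Local Notation half_plane := (@half_plane R).
Local Notation plane := (measurableTypeR R * measurableTypeR R)%type.
Local Notation lam := (@lebesgue_measure R \x @lebesgue_measure R)%E.

(** Each point has its own local extension; no global one has to be constructed. *)
Definition C1_within (D : set (R * R)) (f : R * R -> R) : Prop :=
  forall u, D u -> exists2 g, C1_near u g & extends_near u f g.

Lemma C1_within_continuous (D : set (R * R)) (f : R * R -> R) :
  D `<=` half_plane -> C1_within D f -> {within D, continuous f}.
Proof.
move=> DH fD; apply/subspace_continuousP => u Du.
have [g gu fg] := fD u Du; have [cg _] := nbhs_singleton gu.
have E := nbhs_singleton fg (DH _ Du); rewrite /from_subspace E => A /cg gA.
rewrite /extends_near in fg; apply: filterS2 fg gA => v fgv gAv Dv /=.
by rewrite fgv//; exact: DH.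
Qed.

Lemma C1_within_partial (D : set (R * R)) (f : R * R -> R) (a : 'I_2) :
  D `<=` half_plane -> C1_within D f -> {within D, continuous (partial a f)}.
Proof.
move=> DH fD; apply/subspace_continuousP => u Du.
have [g gu fg] := fD u Du; have [_ /(_ a)[_ cg]] := nbhs_singleton gu.
have {}fg := extends_near_partial a fg gu.
have E := nbhs_singleton fg (DH _ Du); rewrite /from_subspace E => A /cg gA.
rewrite /extends_near in fg; apply: filterS2 fg gA => v fgv gAv Dv /=.
by rewrite fgv//; exact: DH.
Qed.

(** Interior points of the segment have neighbours on the line inside the half plane, so there
    [partial] is the ordinary derivative along the line. At the end points, one of which may lie on
    the boundary, only continuity is used. *)
Lemma line_FTC (D : set (R * R)) (f : R * R -> R) (e : 'I_2) (w : R * R) (a b : R) :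
  a < b -> D `<=` half_plane -> C1_within D f ->
  (forall t, a <= t <= b -> D (t *: vec e + w)) ->
  (forall t, a < t < b -> \forall s \near t, half_plane (s *: vec e + w)) ->
  f (a *: vec e + w) = 0 -> f (b *: vec e + w) = 0 ->
  (\int[lebesgue_measure]_(t in `[a, b]) (partial e f (t *: vec e + w))%:E = 0)%E.
Proof.
move=> ab DH fD lD lH fa fb.
have cl (t : R) : (fun s : R => s *: vec e + w) @ t --> t *: vec e + w.
  by apply: cvgD; [apply: cvgZl; exact: cvg_id|exact: cvg_cst].
have cw (g : R * R -> R) (t : R) : a <= t <= b -> {within D, continuous g} ->
    (fun s : R => g (s *: vec e + w)) @ within `[a, b] (nbhs t) --> g (t *: vec e + w).
  move=> tab cg; have Dt := lD t tab.
  have {}cg := (subspace_continuousP _ _).1 cg _ Dt.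
  move=> A /cg gA.
  have gl : \forall s \near t, D (s *: vec e + w) -> A (g (s *: vec e + w)).
    exact: cl t _ gA.
  apply: filterS gl => s /= gAs.
  by rewrite in_itv/= => sab; apply: gAs; exact: lD.
have cpf := @C1_within_partial D f e DH fD.
have cf := C1_within_continuous DH fD.
have near_line g t : a < t < b -> extends_near (t *: vec e + w) f g ->
    \forall s \near t, g (s *: vec e + w) = f (s *: vec e + w).
  move=> tab fg.
  have fl : \forall s \near t, half_plane (s *: vec e + w) ->
      f (s *: vec e + w) = g (s *: vec e + w) by exact: cl t _ fg.
  by apply: filterS2 (lH t tab) fl => s sH /(_ sH).
have cF : {within `[a, b], continuous (fun t : R => f (t *: vec e + w))}.
  apply/subspace_continuousP => t; rewrite /= in_itv/= => tab; exact: cw.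
rewrite (continuous_FTC2 (F := fun t => f (t *: vec e + w)) ab).
- by rewrite fa fb subee.
- apply/subspace_continuousP => t; rewrite /= in_itv/= => tab; exact: cw.
- split.
  + move=> t; rewrite in_itv/= => tab.
    have /andP[at_ tb] := tab.
    have [g gu fg] := fD _ (lD t (introT andP (conj (ltW at_) (ltW tb)))).
    have [_ /(_ e)[dg _]] := nbhs_singleton gu.
    have fgl : \forall s \near t, g (s *: vec e + w) = f (s *: vec e + w).
      exact: near_line tab fg.
    by apply: near_eq_derivable fgl _; rewrite derivable_line.
  + by have [] := (continuous_within_itvP _ ab).1 cF.
  + by have [] := (continuous_within_itvP _ ab).1 cF.
- move=> t; rewrite in_itv/= => tab; have /andP[at_ tb] := tab.
  have Dt := lD t (introT andP (conj (ltW at_) (ltW tb))).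
  have [g gu fg] := fD _ Dt; have [_ /(_ e)[dg _]] := nbhs_singleton gu.
  have fgl : \forall s \near t, g (s *: vec e + w) = f (s *: vec e + w).
    exact: near_line tab fg.
  rewrite derive1E; have <- := near_eq_derive (1 : R) fgl.
  rewrite derive_line; apply/esym.
  by apply: partial_extends => //; exact: DH.
Qed.

(** The two terms integrate to zero separately: in each, the inner integral runs in the direction of
    differentiation, between two sides on which that component vanishes. *)
Lemma rectangle_divergence (D : set (R * R)) (P : 'I_2 -> R * R -> R)
    (a b c d : R) : a < b -> c < d -> 0 <= a -> rectangle a b c d `<=` D ->
  D `<=` half_plane -> (forall e, C1_within D (P e)) ->
  (forall y, c <= y <= d -> P ord0 (a, y) = 0 /\ P ord0 (b, y) = 0) ->
  (forall x, a <= x <= b -> P ord_max (x, c) = 0 /\ P ord_max (x, d) = 0) ->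
  (\int[lam]_(u in (rectangle a b c d : set plane))
     (partial ord0 (P ord0) u + partial ord_max (P ord_max) u)%:E = 0)%E.
Proof.
move=> ab cd a0 rD DH PD P0 P1.
have cP e : {within rectangle a b c d, continuous (partial e (P e))}.
  by apply: continuous_subspaceW rD _; exact: C1_within_partial.
have mr := measurable_rectangle a b c d.
under eq_integral do rewrite EFinD.
rewrite (integralD mr (rectangle_integrable (cP ord0)) (rectangle_integrable (cP ord_max))).
rewrite rectangle_integral_fst ?rectangle_integral_snd ?adde0//.
- move=> x; rewrite in_itv/= => xab; have [Pc Pd] := P1 x xab.
  have l y : y *: vec ord_max + (x, 0) = (x, y) by rewrite line1E addr0.
  have /andP[ax xb] := xab.
  rewrite (eq_integral (fun t : measurableTypeR R => (partial ord_max (P ord_max)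
    ((t : R) *: vec ord_max + (x, 0)))%:E)); last by move=> t _; rewrite l.
  apply: (line_FTC cd DH (PD _)); rewrite ?l//.
  + by move=> t tcd; rewrite l; apply: rD; split; rewrite /= in_itv/=.
  + move=> t _; apply: filterE => s; rewrite l /half_plane/=; exact: le_trans ax.
- move=> y; rewrite in_itv/= => ycd; have [Pa Pb] := P0 y ycd.
  have l x : x *: vec ord0 + (0, y) = (x, y) by rewrite line0E addr0.
  rewrite (eq_integral (fun t : measurableTypeR R => (partial ord0 (P ord0)
    ((t : R) *: vec ord0 + (0, y)))%:E)); last by move=> t _; rewrite l.
  apply: (line_FTC ab DH (PD _)); rewrite ?l//.
  + by move=> t tab; rewrite l; apply: rD; split; rewrite /= in_itv/=.
  + move=> t /andP[at_ _].
    have t0 : 0 < t by exact: le_lt_trans a0 at_.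
    by apply: filterS (@cvgr_gt _ _ (nbhs t) _ id t (@cvg_id _ _) 0 t0) => s s0; rewrite l /half_plane/= ltW.
Qed.

End RectangleDivergence.

(** * Change of variables *)

Section DensityTransfer.
Local Open Scope ereal_scope.
Context d d' (X : measurableType d) (Y : measurableType d') (R : realType).
Variables (mu : {measure set X -> \bar R}) (lam : {measure set Y -> \bar R}).
Variables (A : set X) (D : set Y) (phi : Y -> X) (w : Y -> R).
Hypotheses (mA : measurable A) (mD : measurable D).
Hypotheses (DA : forall u, D u -> A (phi u)) (mphi : measurable_fun D phi).
Hypotheses (mw : measurable_fun D w) (w0 : forall u, D u -> (0 <= w u)%R).
Hypothesis muE : forall B, measurable B -> B `<=` A ->
  mu B = \int[lam]_(u in D `&` phi @^-1` B) (w u)%:E.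

Import HBNNSimple.

(** On each level set of [h] the identity is [muE], which says that [mu] on [A] is the image under
    [phi] of the measure with density [w]. *)
Lemma nnsfun_integral_transfer (h : {nnsfun X >-> R}) :
  \int[mu]_(x in A) (h x)%:E = \int[lam]_(u in D) ((h (phi u))%:E * (w u)%:E).
Proof.
have mh y : measurable (h @^-1` [set y]) by exact: measurable_funPTI.
transitivity (\int[mu]_(x in A)
   (\sum_(y \in range h) (y * \1_(h @^-1` [set y]) x)%:E)).
  by apply: eq_integral => t tE; rewrite fsumEFin// -fimfunE.
rewrite ge0_integral_fsum//; last 2 first.
- by move=> y; apply/measurable_EFinP; apply: measurable_funM => //; exact: measurable_indic.
- by move=> y x _; exact: nnfun_muleindic_ge0.
transitivity (\int[lam]_(u in D) (\sum_(y \in range h)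
    (y * \1_(h @^-1` [set y]) (phi u))%:E * (w u)%:E)); last first.
  apply: eq_integral => u uD.
  rewrite -ge0_mule_fsuml; last by move=> y; exact: nnfun_muleindic_ge0.
  by rewrite fsumEFin// -fimfunE.
have mi y : measurable_fun D (fun u => (y * \1_(h @^-1` [set y]) (phi u))%:E).
  apply/measurable_EFinP; apply: measurable_funM => //.
  exact: (measurableT_comp (measurable_indic (mh y)) mphi).
have mwE : measurable_fun D (fun u => (w u)%:E) by exact/measurable_EFinP.
rewrite ge0_integral_fsum//; last 2 first.
- by move=> y; apply: emeasurable_funM.
- by move=> y u Du; rewrite mule_ge0 ?nnfun_muleindic_ge0 ?lee_fin ?w0.
apply: eq_fsbigr => r; rewrite inE => -[x _ hx].
have r0 : (0 <= r)%R by rewrite -hx.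
rewrite integralZl_indic_nnsfun// integral_indic//.
rewrite muE; [|exact: measurableI|exact: subIsetr].
under [RHS]eq_integral do rewrite EFinM -muleA.
rewrite ge0_integralZl//; last 2 first.
- apply: emeasurable_funM => //; apply/measurable_EFinP.
  exact: (measurableT_comp (measurable_indic (mh r)) mphi).
- by move=> u Du; rewrite mule_ge0 ?lee_fin ?w0.
(* Restricting the domain to the preimage of a level set is multiplying by its indicator; [DA] makes
   the intersection with [A] automatic. *)
congr (_ * _); rewrite integral_mkcondr; apply: eq_integral => u; rewrite inE => Du.
rewrite patchE /= indicE; case: ifPn.
  rewrite inE /= => -[hu _]; rewrite mem_set// ?mul1e//.
rewrite notin_setE => H; rewrite memNset ?mul0e// => hu; apply: H; split => //.
exact: DA.
Qed.

(** Monotone convergence on both sides along the same increasing sequence of simple functions. *)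
Lemma ge0_integral_transfer (f : X -> \bar R) :
  measurable_fun A f -> (forall x, A x -> 0 <= f x) ->
  \int[mu]_(x in A) f x = \int[lam]_(u in D) (f (phi u) * (w u)%:E).
Proof.
move=> mf f0; pose h := nnsfun_approx mA mf.
have mwE : measurable_fun D (fun u => (w u)%:E) by exact/measurable_EFinP.
have -> : \int[mu]_(x in A) f x = lim (\int[mu]_(x in A) (h n x)%:E @[n --> \oo]).
  have fE x : A x -> f x = lim ((h n x)%:E @[n --> \oo]).
    by move=> Ax; apply/esym/cvg_lim => //; exact: cvg_nnsfun_approx.
  under eq_integral => x /[!inE] /fE -> //.
  apply: monotone_convergence => //.
  - move=> n; apply/measurable_EFinP.
    by apply: (measurable_funS measurableT) => //; exact/measurable_funP.
  - by move=> n x Ax //=; rewrite lee_fin.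
  - by move=> x Ax a b ab; rewrite lee_fin; exact/lefP/nd_nnsfun_approx.
under eq_fun do rewrite nnsfun_integral_transfer.
have fgE u : D u -> f (phi u) * (w u)%:E = lim (((h n (phi u))%:E * (w u)%:E) @[n --> \oo]).
  move=> Du; apply/esym/cvg_lim => //; apply: cvgeZr => //.
  by apply: cvg_nnsfun_approx => //; exact: DA.
under [RHS]eq_integral => u /[!inE] /fgE -> //.
apply/esym; apply: monotone_convergence => //.
- move=> n; apply: emeasurable_funM => //; apply/measurable_EFinP.
  by apply: measurableT_comp mphi; exact/measurable_funP.
- by move=> n u Du; rewrite mule_ge0 ?lee_fin ?w0.
- move=> u Du a b ab; rewrite lee_wpmul2r ?lee_fin ?w0//.
  exact/lefP/nd_nnsfun_approx.
Qed.

(** As [w] is nonnegative, multiplication by it commutes with taking positive and negative parts,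
    which are transferred separately. *)
Lemma integral_transfer (f : X -> R) : measurable_fun A f ->
  \int[mu]_(x in A) (f x)%:E = \int[lam]_(u in D) (f (phi u) * w u)%:E.
Proof.
move=> mf; have mfE : measurable_fun A (EFin \o f) by exact/measurable_EFinP.
rewrite integralE [RHS]integralE !ge0_integral_transfer//.
- congr (_ - _); apply: eq_integral => u; rewrite inE => Du.
    by rewrite !funeposE -!EFin_max -EFinM maxr_pMl ?w0// mul0r.
  by rewrite !funenegE -!EFinN -!EFin_max -EFinM maxr_pMl ?w0// mul0r mulNr.
- exact: measurable_funeneg.
- exact: measurable_funepos.
Qed.

Lemma integrable_transfer (f : X -> R) : measurable_fun A f ->
  lam.-integrable D (fun u => (f (phi u) * w u)%:E) ->
  mu.-integrable A (EFin \o f).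
Proof.
move=> mf /integrableP[_ fi]; apply/integrableP; split; first exact/measurable_EFinP.
rewrite ge0_integral_transfer//; last first.
  by apply: measurableT_comp => //; exact/measurable_EFinP.
suff <- : \int[lam]_(u in D) `|(f (phi u) * w u)%:E| =
    \int[lam]_(u in D) (`|(EFin \o f) (phi u)| * (w u)%:E) by [].
apply: eq_integral => u; rewrite inE => Du.
by rewrite /= -EFinM normrM (ger0_norm (w0 Du)).
Qed.

End DensityTransfer.

(** * Additivity and locality of the integrand, regularity of the area density *)

Section LocalIntegral.
Context {R : realType}.
Local Notation vec := (@coord_vector R).
Local Notation half_plane := (@half_plane R).
Local Notation plane := (measurableTypeR R * measurableTypeR R)%type.
Local Notation lam := (@lebesgue_measure R \x @lebesgue_measure R)%E.

Lemma frame_densityD i x F S (L L' : 'rV[R]_4) dL dL' :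
  frame_density i x F S (L + L') (fun a => dL a + dL' a) =
  frame_density i x F S L dL + frame_density i x F S L' dL'.
Proof.
rewrite !frame_density_trace !sum_I2.
have -> : wdg i x (L + L') = wdg i x L + wdg i x L' by rewrite /wdg !mxE; ring.
rewrite !frame_projD; move: (frame_proj F) (invmx _) => P A.
by rewrite !QDr; ring.
Qed.

Lemma frame_density0 i x F S :
  frame_density i x F S (0 : 'rV[R]_4) (fun=> 0) = 0.
Proof.
have := frame_densityD i x F S 0 0 (fun=> 0) (fun=> 0).
rewrite addr0 => /eqP; rewrite eq_sym -subr_eq0 addrK => /eqP E.
exact: E.
Qed.

Section OnSurface.
Variables (i : 'I_4) (Sigma : surface R) (F : Sigma -> 'rV[R]_4).
Hypotheses (himm : immersion F) (hspace : spacelike F).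

Lemma C1_atD (V : normedModType R) c p (L L' : Sigma -> V) :
  C1_at c L p -> C1_at c L' p -> C1_at c (fun q => L q + L' q) p.
Proof.
move=> [g gu Lg] [g' gu' Lg']; exists (fun v => g v + g' v); first exact: C1_nearD.
rewrite /extends_near in Lg Lg' *; apply: filterS2 Lg Lg' => v e e' v0.
by rewrite /= -(e v0) -(e' v0).
Qed.

Lemma C1_at_sum (V : normedModType R) c p (I : Type) (s : seq I)
    (L : I -> Sigma -> V) :
  (forall j, C1_at c (L j) p) -> C1_at c (fun q => \sum_(j <- s) L j q) p.
Proof.
move=> Lp; elim: s => [|k s IH].
  under eq_fun do rewrite big_nil.
  exists (cst 0); first exact: C1_near_cst.
  by apply: (@filterE _ (nbhs _)).
by under eq_fun do rewrite big_cons; exact: C1_atD.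
Qed.

(** [diff_at] is a [lim], hence additive where the limits exist; the hypotheses [C1_at] provide
    this. *)
Lemma integrandD p (L L' : Sigma -> 'rV[R]_4) :
  C1_at (chart_at p) L p -> C1_at (chart_at p) L' p ->
  integrand i F (fun q => L q + L' q) p = integrand i F L p + integrand i F L' p.
Proof.
have ca := chart_at_atlas p; have cd := chart_at_dom p.
move=> Lp Lp'; have C1D := C1_atD Lp Lp'.
rewrite !(integrand_chart i himm hspace ca cd)// -frame_densityD.
congr frame_density; apply/funext => a.
case: Lp Lp' => g gu Lg [g' gu' Lg'].
rewrite (diff_at_extends a ca cd gu Lg) (diff_at_extends a ca cd gu' Lg').
have Lgg : extends_near (coord (chart_at p) p)
    ((fun q => L q + L' q) \o param (chart_at p)) (fun v => g v + g' v).
  rewrite /extends_near in Lg Lg' *; apply: filterS2 Lg Lg' => v e e' v0.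
  by rewrite /= -(e v0) -(e' v0).
rewrite (diff_at_extends a ca cd (C1_nearD gu gu') Lgg).
have [_ /(_ a)[dg _]] := nbhs_singleton gu.
have [_ /(_ a)[dg' _]] := nbhs_singleton gu'.
exact: deriveD.
Qed.

(** Since the integrand involves derivatives of [L], it is the vanishing on a neighbourhood that
    makes it vanish at [p]. *)
Lemma integrand_eq0 p (A : set Sigma) (L : Sigma -> 'rV[R]_4) :
  open A -> A p -> (forall q, A q -> L q = 0) -> integrand i F L p = 0.
Proof.
move=> oA Ap L0; have ca := chart_at_atlas p; have cd := chart_at_dom p.
have e0 : extends_near (coord (chart_at p) p) (L \o param (chart_at p)) (cst 0).
  have := param_near ca cd oA Ap; apply: filterS => v Nv v0.
  by have [q [cq Aq qv vq]] := Nv v0; rewrite /= vq L0.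
have c0 := C1_near_cst (coord (chart_at p) p) (0 : 'rV[R]_4).
rewrite (integrand_chart i himm hspace ca cd); last by exists (cst 0).
rewrite L0// -[RHS](frame_density0 i (F p) (frame F (chart_at p) p)
  (fun a b => diff2_at (chart_at p) a b F p)).
congr frame_density; apply/funext => a.
by rewrite (diff_at_extends a ca cd c0 e0); exact: derive_cst.
Qed.

Lemma integrand_sum p (I : Type) (s : seq I) (L : I -> Sigma -> 'rV[R]_4) :
  (forall j, C1_at (chart_at p) (L j) p) ->
  integrand i F (fun q => \sum_(j <- s) L j q) p = \sum_(j <- s) integrand i F (L j) p.
Proof.
move=> Lp; elim: s => [|j s IH].
  rewrite big_nil; apply: (@integrand_eq0 _ setT) => // [|q _]; first exact: openT.
  by rewrite big_nil.
have -> : (fun q => \sum_(j0 <- j :: s) L j0 q) = (fun q => L j q + \sum_(j0 <- s) L j0 q).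
  by apply/funext => q; rewrite big_cons.
rewrite big_cons; refine (etrans (integrandD (Lp j) (C1_at_sum s Lp)) _).
by congr (_ + _).
Qed.

Definition area_density (c : chart R Sigma) (u : R * R) : R :=
  Num.sqrt (\det (gram (frame F c (param c u)))).

(** The root is differentiable only at positive arguments: positivity of the Gram determinant is
    what makes the density C^1. *)
Lemma area_density_C1 c : atlas c ->
  C1_within (coord c @` dom c) (area_density c).
Proof.
move=> ac u [p cp <-].
have [U [gF [oU Uu sgF FgF]]] := smooth_extends himm.1 ac cp.
have gFu := smooth_open_C1_near oU Uu sgF.
have phiu a := smooth_open_C1_near oU Uu (smooth_open_derive a sgF).
have ephi a := extends_near_partial a FgF gFu.
have [_ _ pK _ _] := atlas_charts ac.
pose g b d v := mink ('D_(vec b) gF v) ('D_(vec d) gF v).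
have gu b d : C1_near (coord c p) (g b d) := C1_near_mink (phiu b) (phiu d).
pose G v := g ord0 ord0 v * g ord_max ord_max v - g ord0 ord_max v * g ord0 ord_max v.
have Gc : C1_near (coord c p) G := C1_nearMBM (gu _ _) (gu _ _) (gu _ _) (gu _ _).
have eG : extends_near (coord c p) (fun u => \det (gram (frame F c (param c u)))) G.
  have e0 := ephi ord0; have e1 := ephi ord_max.
  have Dn := param_near ac cp openT I; rewrite /extends_near in e0 e1 *.
  apply: filterS3 e0 e1 Dn => v e0v e1v Dv v0.
  have [q [cq _ qv vq]] := Dv v0.
  have frq : frame F c q = (fun a => 'D_(vec a) gF v).
    apply/funext; apply: forall_I2; rewrite /frame /diff_at qv; [exact: e0v|exact: e1v].
  by rewrite vq frq det_gram.
have G0 : 0 < G (coord c p).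
  rewrite -(nbhs_singleton eG (half_plane_coord ac cp)) pK//.
  exact: det_gram_chart.
exists (fun v => Num.sqrt (G v)); first exact: C1_near_sqrt.
exact: extends_near_comp eG.
Qed.

End OnSurface.
End LocalIntegral.

(** * Integration of fields supported in a chart *)

Section ChartIntegral.
Context {R : realType}.
Local Notation vec := (@coord_vector R).
Local Notation half_plane := (@half_plane R).
Local Notation plane := (measurableTypeR R * measurableTypeR R)%type.
Local Notation lam := (@lebesgue_measure R \x @lebesgue_measure R)%E.
Variables (Sigma : surface R) (c : chart R Sigma).
Hypothesis ac : atlas c.
Local Notation D := (coord c @` dom c).

Lemma coord_image_half_plane : D `<=` half_plane.
Proof. by move=> u [p cp <-]; exact: half_plane_coord. Qed.

Lemma coord_image_measurable : measurable (D : set plane).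
Proof.
have [_ [W oW ->] _ _ _] := atlas_charts ac.
apply: measurableI; first exact: open_measurable_plane.
rewrite -[X in measurable X]setCK; apply: measurableC; apply: open_measurable_plane.
have -> : ~` half_plane = fst @^-1` [set x : R | x < 0].
  by apply/seteqP; split => u; rewrite /half_plane/= ltNge => /negP.
by apply: open_comp; [move=> *; exact: cvg_fst|exact: open_lt].
Qed.

Lemma open_borel_measurable (A : set Sigma) : open A -> measurable (A : set (borel Sigma)).
Proof. by move=> oA; exact: sub_sigma_algebra. Qed.

Lemma param_measurable : measurable_fun (D : set plane) (param c : plane -> borel Sigma).
Proof.
have [_ _ _ _ cp] := atlas_charts ac.
have gO : @measurable _ (borel Sigma) = <<s (@open Sigma : set (set (borel Sigma))) >> by [].
apply: (measurability _ gO).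
move=> _ [V oV <-]; have /continuousP := cp => /(_ V oV)/open_subspaceP[U oU E].
rewrite setIC; have := E; rewrite /from_subspace => <-.
by apply: measurableI; [exact: open_measurable_plane|exact: coord_image_measurable].
Qed.

Lemma coord_image_preimage (B : set Sigma) : B `<=` dom c ->
  coord c @` B = D `&` param c @^-1` B.
Proof.
have [_ _ pK _ _] := atlas_charts ac.
move=> Bc; apply/seteqP; split => u.
  by move=> [p Bp <-]; split; [exists p => //; exact: Bc|rewrite /= pK//; exact: Bc].
by move=> [[p cp <-]] /=; rewrite pK// => Bp; exists p.
Qed.

(** Continuity is checked for the expression in coordinates and transported by [coord c]; it yields
    Borel measurability on the chart domain. *)
Lemma chart_function_measurable (f : Sigma -> R) (g : R * R -> R) :
  {within D, continuous g} -> (forall p, dom c p -> f p = g (coord c p)) ->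
  measurable_fun (dom c : set (borel Sigma)) (f : borel Sigma -> R).
Proof.
move=> cg fg; have [oc _ pK cc _] := atlas_charts ac.
have cf : {within dom c, continuous f}.
  apply/subspace_continuousP => p cp A fA.
  have Dp : D (coord c p) by exists p.
  have gA : nbhs (g (coord c p)) A by rewrite -fg.
  have gn := (subspace_continuousP _ _).1 cg _ Dp A gA.
  have nq : \forall q \near p, dom c q -> D (coord c q) -> A (g (coord c q)).
    exact: (subspace_continuousP _ _).1 cc p cp _ gn.
  have : \forall q \near p, dom c q -> A (f q).
    by apply: filterS nq => q H cq; rewrite fg//; apply: H => //; exists q.
  by [].
move=> mc; apply: (measurability _ (measurable_realfun.RGenOpens.measurableE R)) => //.
move=> _ [_ [x [y ->] <-]].
have oxy : open `]x, y[%classic by exact: interval_open.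
have /continuousP := cf => /(_ _ oxy)/open_subspaceP[U oU E].
rewrite setIC; have := E; rewrite /from_subspace => <-.
by apply: measurableI; exact: open_borel_measurable.
Qed.

Section Compact.
Variables (a b d e : R).
Hypothesis rD : rectangle a b d e `<=` D.

Lemma param_rectangle_dom : param c @` rectangle a b d e `<=` dom c.
Proof.
have [_ _ pK _ _] := atlas_charts ac.
by move=> _ [u /rD[p cp <-] <-]; rewrite pK.
Qed.

(** A compact image in a Hausdorff space. The complement is therefore open, which allows fields
    supported in the rectangle to be treated as locally zero outside it. *)
Lemma param_rectangle_closed : closed (param c @` rectangle a b d e).
Proof.
have [_ _ _ _ cp] := atlas_charts ac.
apply: compact_closed; first exact: surface_hausdorff.
apply: continuous_compact; first exact: continuous_subspaceW rD cp.
by apply: compact_setX; exact: segment_compact.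
Qed.

End Compact.

Variables (i : 'I_4) (F : Sigma -> 'rV[R]_4).
Hypotheses (himm : immersion F) (hspace : spacelike F).
Hypothesis hbdry : forall p : Sigma, boundary p -> de_sitter (F p).
Hypothesis horth : orthogonal_to_de_sitter F.
Variable mu : {measure set (borel Sigma) -> \bar R}.
Hypothesis hmu : is_area_measure F mu.
Variables (a b d e : R) (L : Sigma -> 'rV[R]_4).
Hypotheses (a0 : 0 <= a) (ab : a < b) (de : d < e).
Hypothesis rD : rectangle a b d e `<=` D.
Hypothesis hnorm : forall p, normal_space F p (L p).
Hypothesis hC1 : forall p, dom c p -> C1_at c L p.
Hypothesis L0 : forall p, ~ (param c @` rectangle a b d e) p -> L p = 0.
(** The left side is exempt when [a = 0]: there it lies on the boundary line, and the flux vanishes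
    by the boundary condition instead. *)
Hypothesis Ls : forall u, rectangle a b d e u ->
  u.1 = b \/ u.2 = d \/ u.2 = e \/ (u.1 = a /\ a != 0) -> L (param c u) = 0.

Let f : Sigma -> R := integrand i F L.
Let h (u : R * R) : R := partial ord0 (flux i F L c ord0) u
                         + partial ord_max (flux i F L c ord_max) u.
Let w := area_density F c.

Let flux_C1 k : C1_within D (flux i F L c k).
Proof.
move=> _ [p cp <-]; have [P [Pu eP _]] := flux_local i himm hspace hnorm ac cp (hC1 cp).
by exists (P k).
Qed.

Let hE u : D u -> h u = f (param c u) * w u.
Proof.
move=> [p cp <-]; have [_ _ pK _ _] := atlas_charts ac.
have [P [Pu eP E]] := flux_local i himm hspace hnorm ac cp (hC1 cp).
have u0 := half_plane_coord ac cp.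
have D0 : partial ord0 (flux i F L c ord0) (coord c p) = 'D_(vec ord0) (P ord0) (coord c p).
  by apply: partial_extends => //; have [_ /(_ ord0)[]] := nbhs_singleton (Pu ord0).
have D1 : partial ord_max (flux i F L c ord_max) (coord c p) = 'D_(vec ord_max) (P ord_max) (coord c p).
  by apply: partial_extends => //; have [_ /(_ ord_max)[]] := nbhs_singleton (Pu ord_max).
refine (etrans (f_equal2 +%R D0 D1) (etrans E _)).
by rewrite /w /area_density pK// mulrC.
Qed.

Let w_gt0 u : D u -> 0 < w u.
Proof.
move=> [p cp <-]; have [_ _ pK _ _] := atlas_charts ac.
by rewrite /w /area_density pK// sqrtr_gt0; exact: det_gram_chart.
Qed.

Let f0 p : ~ (param c @` rectangle a b d e) p -> f p = 0.
Proof.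
move=> Kp.
apply: (@integrand_eq0 _ i _ _ himm hspace p (~` (param c @` rectangle a b d e))) => //.
by rewrite openC; exact: param_rectangle_closed.
Qed.

Let ch : {within D, continuous h}.
Proof.
have DH := coord_image_half_plane.
move=> u; apply: cvgD; exact: (C1_within_partial (a := _) DH (flux_C1 _)).
Qed.

Let cw : {within D, continuous w}.
Proof.
exact: C1_within_continuous coord_image_half_plane (area_density_C1 himm hspace ac).
Qed.

(** The pointwise choice of charts in the integrand hides its regularity; in the chart [c] it is the
    quotient [h / w] of two continuous functions. *)
Let mf : measurable_fun (dom c : set (borel Sigma)) (f : borel Sigma -> R).
Proof.
apply: (@chart_function_measurable f (fun u => h u * (w u)^-1)).
  apply/subspace_continuousP => u Du; apply: cvgM.
    exact: ((subspace_continuousP _ _).1 ch).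
  apply: cvgV; first by rewrite gt_eqF// w_gt0.
  exact: ((subspace_continuousP _ _).1 cw).
have [_ _ pK _ _] := atlas_charts ac.
move=> p cp; have Dp : D (coord c p) by exists p.
by rewrite hE// pK// mulfK// gt_eqF// w_gt0.
Qed.

(** Outside the rectangle [L] vanishes locally, hence so does [h]. As [param c] is injective on the
    coordinate image, a point outside the rectangle is not sent into the image of the rectangle. *)
Let hpatch : ((EFin \o h) \_ (D : set plane)) = ((EFin \o h) \_ (rectangle a b d e : set plane)).
Proof.
apply/funext => u; rewrite !patchE; case: ifPn; rewrite ?inE ?notin_setE => Du.
  case: ifPn => //; rewrite notin_setE => ru; rewrite /= hE//.
  rewrite f0 ?mul0r// => -[v rv vu]; apply: ru.
  have [_ _ pK _ _] := atlas_charts ac.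
  move: rv vu; case: (Du) => p cp <- rv; rewrite pK// => pE.
  by have [q cq qE] := rD rv; move: pE; rewrite -qE pK// => <-; rewrite qE.
by rewrite ifN// notin_setE => /rD.
Qed.

Let muE (B : set (borel Sigma)) : measurable B -> B `<=` dom c ->
  mu B = (\int[lam]_(u in (D : set plane) `&` param c @^-1` B) (w u)%:E)%E.
Proof. by move=> mB Bc; rewrite (hmu ac mB Bc) coord_image_preimage. Qed.

Let mdom : measurable (dom c : set (borel Sigma)).
Proof. by apply: open_borel_measurable; have [] := atlas_charts ac. Qed.

Let Ddom u : D u -> dom c (param c u).
Proof. by have [_ _ pK _ _] := atlas_charts ac => -[p cp <-]; rewrite pK. Qed.

Let fpatch : (EFin \o f) \_ (dom c) = EFin \o f.
Proof.
apply/funext => p; rewrite patchE; case: ifPn => //; rewrite notin_setE => ncp.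
by rewrite /= f0// => /(param_rectangle_dom rD).
Qed.

Let mw : measurable_fun (D : set plane) (w : plane -> R).
Proof. exact: continuous_within_measurable coord_image_measurable cw. Qed.

Let w_ge0 u : D u -> 0 <= w u.
Proof. by move=> /w_gt0/ltW. Qed.

(** The integral passes from the surface to the chart domain, then to its coordinate image, and
    finally to the rectangle; the first and last restrictions discard regions where the integrand is
    zero. *)
Lemma chart_integral : (\int[mu]_p (integrand i F L p)%:E = 0)%E.
Proof.
have E : (\int[mu]_p (integrand i F L p)%:E = \int[mu]_(p in dom c) (f p)%:E)%E.
  by rewrite [RHS]integral_mkcond -[RHS]/(\int[mu]_p (((EFin \o f) \_ (dom c)) p))%E fpatch.
rewrite E (integral_transfer mdom coord_image_measurable Ddom param_measurable mw w_ge0 muE mf).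
transitivity (\int[lam]_(u in (D : set plane)) (EFin \o h) u)%E.
  by apply: eq_integral => u; rewrite inE => Du; rewrite /= hE.
rewrite integral_mkcond hpatch -integral_mkcond.
have rE x y : a <= x <= b -> d <= y <= e -> rectangle a b d e (x, y).
  by split; rewrite /= in_itv.
have aab : a <= a <= b by rewrite lexx ltW.
have bab : a <= b <= b by rewrite lexx ltW.
have dde : d <= d <= e by rewrite lexx ltW.
have ede : d <= e <= e by rewrite lexx ltW.
apply: (rectangle_divergence ab de a0 rD coord_image_half_plane flux_C1).
- move=> y yde; split; last by apply: flux_eq0; apply: Ls; [exact: rE|left].
  have rab : rectangle a b d e (a, y) by exact: rE.
  (* Either the left side lies inside the half plane, where [L] vanishes on it, or it is part of the
     boundary of the surface. *)
  have [az|an0] := eqVneq a 0; last first.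
    by apply: flux_eq0; apply: Ls => //; right; right; right.
  have [p cp pE] := rD rab; rewrite -pE.
  have p10 : (coord c p).1 = 0 by rewrite pE.
  exact: (flux_eq0_boundary i himm hnorm hbdry horth ac cp p10).
- move=> x xab; split; apply: flux_eq0; apply: Ls.
  + exact: rE.
  + by right; left.
  + exact: rE.
  + by right; right; left.
Qed.

(** Needed to exchange the integral with the finite sum over the partition of unity. *)
Lemma chart_integrable : mu.-integrable setT (EFin \o integrand i F L).
Proof.
rewrite -[EFin \o _]fpatch; apply/(integrable_mkcond _ mdom).
apply: (integrable_transfer mdom coord_image_measurable Ddom param_measurable mw w_ge0 muE mf).
have : lam.-integrable (D : set plane) (EFin \o h).
  apply/(integrable_mkcond _ coord_image_measurable); rewrite hpatch.
  apply/(integrable_mkcond _ (measurable_rectangle a b d e)).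
  by apply: rectangle_integrable; exact: continuous_subspaceW rD ch.
apply: eq_integrable; first exact: coord_image_measurable.
by move=> u; rewrite inE => Du; rewrite /= hE.
Qed.

End ChartIntegral.

(** * Partition of unity *)

Section Bump.
Context {R : realType}.
Local Notation vec := (@coord_vector R).

(** The square makes the positive part C^1, the regularity that a cut-off of [L] requires. *)
Definition pos_sq (x : R) : R := Num.max 0 x ^+ 2.

Lemma is_derive_pos_sq (x : R) : is_derive x (1 : R) pos_sq (2 * Num.max 0 x).
Proof.
have [x0|x0|->] := ltrgtP x 0.
- have E : \forall y \near x, (cst 0 : R -> R) y = pos_sq y.
    have : \forall y \near x, y < 0 by exact: (@cvgr_lt _ _ (nbhs x) _ id x (@cvg_id _ _) 0 x0).
    by apply: filterS => y y0; rewrite /pos_sq max_l ?ltW// expr0n.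
  have := near_eq_is_derive E (is_derive_cst (0 : R) x (1 : R)).
  by rewrite mulr0.
- have E : \forall y \near x, (fun y : R => y ^+ 2) y = pos_sq y.
    have : \forall y \near x, 0 < y by exact: (@cvgr_gt _ _ (nbhs x) _ id x (@cvg_id _ _) 0 x0).
    by apply: filterS => y y0; rewrite /pos_sq max_r ?ltW.
  have := near_eq_is_derive E (is_deriveX 2 (is_derive_id x (1 : R))).
  by rewrite /= expr1 [_ *: 1]mulr1.
(* At [0] the difference quotient is bounded in absolute value by [|h|]. *)
- rewrite mulr0.
  have H : (fun h : R => h^-1 *: ((pos_sq \o shift 0) (h *: (1:R)) - pos_sq 0)) @ 0^' --> (0 : R).
    apply/cvgrPdist_le => e e0.
    have N : \forall h \near (0 : R)^', `|h| < e by apply: nbhs_dnbhs; exact: (@nbhs0_lt R R).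
    apply: filterS N => h he; rewrite sub0r normrN /= addr0 [h *: 1]mulr1.
    rewrite /pos_sq maxxx expr0n subr0 [_ *: _]/GRing.scale/= normrM normfV.
    have hm : Num.max 0 h ^+ 2 <= `|h| ^+ 2.
      by rewrite lerXn2r ?nnegrE ?le_max ?lexx// ge_max normr_ge0 ler_norm.
    rewrite (ger0_norm (sqr_ge0 _)); have [->|h0] := eqVneq h 0.
      by rewrite normr0 invr0 mul0r ltW.
    rewrite mulrC ler_pdivrMr ?normr_gt0//; apply: le_trans hm _.
    by rewrite expr2 ler_wpM2r// ltW.
  by apply: DeriveDef; [apply/cvg_ex; exists 0|exact: cvg_lim H].
Qed.

Lemma continuous_max0 (x : R) : {for x, continuous (fun y : R => 2 * Num.max 0 y)}.
Proof.
apply: cvgM; first exact: cvg_cst.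
by apply: (@continuous_max _ _ (cst 0) id); [exact: cvg_cst|exact: cvg_id].
Qed.

Lemma C1_near_pos_sq (u : R * R) (f : R * R -> R) :
  C1_near u f -> C1_near u (fun v => pos_sq (f v)).
Proof.
move=> fu; apply: (C1_near_comp1 (dg := fun y => 2 * Num.max 0 y)) => //.
apply: (@filterE _ (nbhs (f u))) => x; split; first exact: is_derive_pos_sq.
exact: continuous_max0.
Qed.

Lemma C1_near_fst (u : R * R) : C1_near u (fun v : R * R => v.1).
Proof.
apply: (@C1_near_intro _ _ _ _ (fun a => cst (vec a).1)).
apply: (@filterE _ (nbhs u)) => v; split; first exact: cvg_fst.
move=> a; split; last exact: cvg_cst.
exact: is_derive_fst (is_derive_id v (vec a)).
Qed.

Lemma C1_near_snd (u : R * R) : C1_near u (fun v : R * R => v.2).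
Proof.
apply: (@C1_near_intro _ _ _ _ (fun a => cst (vec a).2)).
apply: (@filterE _ (nbhs u)) => v; split; first exact: cvg_snd.
move=> a; split; last exact: cvg_cst.
exact: is_derive_snd (is_derive_id v (vec a)).
Qed.

(** A product of one factor per coordinate, positive on the open square of half-side [r] around [u0]
    and zero elsewhere when [r > 0]; this matches the rectangles on which the divergence theorem is
    proved. *)
Definition bump (u0 : R * R) (r : R) (u : R * R) : R :=
  pos_sq (r ^+ 2 - (u.1 - u0.1) ^+ 2) * pos_sq (r ^+ 2 - (u.2 - u0.2) ^+ 2).

Lemma bump_C1 u0 r u : C1_near u (bump u0 r).
Proof.
have C (x : R) : C1_near u (cst x) by exact: C1_near_cst.
apply: C1_nearM; apply: C1_near_pos_sq.
  apply: (C1_nearD (C _)); apply: C1_nearN.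
  have H := C1_nearD (C1_near_fst u) (C (- u0.1)).
  exact: (C1_nearM H H).
apply: (C1_nearD (C _)); apply: C1_nearN.
have H := C1_nearD (C1_near_snd u) (C (- u0.2)).
exact: (C1_nearM H H).
Qed.

Lemma pos_sq_ge0 x : 0 <= pos_sq x. Proof. exact: sqr_ge0. Qed.

Lemma bump_ge0 u0 r u : 0 <= bump u0 r u.
Proof. by rewrite mulr_ge0// pos_sq_ge0. Qed.

Lemma pos_sq_gt0 x : 0 < x -> 0 < pos_sq x.
Proof. by move=> x0; rewrite /pos_sq max_r ?ltW// exprn_gt0. Qed.

Lemma pos_sq_eq0 x : x <= 0 -> pos_sq x = 0.
Proof. by move=> x0; rewrite /pos_sq max_l// expr0n. Qed.

Lemma bump_gt0 u0 r u : ball u0 r u -> 0 < bump u0 r u.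
Proof.
have S (x y : R) : `|x - y| < r -> 0 < r ^+ 2 - (y - x) ^+ 2.
  move=> xy; rewrite subr_gt0 -[ltLHS]real_normK ?num_real// distrC.
  by rewrite ltr_pXn2r ?nnegrE// ?(le_trans _ (ltW xy)).
by move=> [u1 u2]; rewrite mulr_gt0// pos_sq_gt0//; exact: S.
Qed.

Lemma bump_eq0 u0 r u : 0 < r -> r <= `|u.1 - u0.1| \/ r <= `|u.2 - u0.2| ->
  bump u0 r u = 0.
Proof.
move=> r0; have S (x : R) : r <= `|x| -> r ^+ 2 - x ^+ 2 <= 0.
  move=> rx; rewrite subr_le0 -[leRHS]real_normK ?num_real//.
  by rewrite lerXn2r// nnegrE ltW.
by case=> /S /pos_sq_eq0 E; rewrite /bump E ?mul0r ?mulr0.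
Qed.

End Bump.

(** * Cut-off functions on the surface *)

Section Partition.
Context {R : realType} {Sigma : surface R}.
Local Notation vec := (@coord_vector R).
Local Notation half_plane := (@half_plane R).
Implicit Types (c : chart R Sigma) (p q : Sigma).

Lemma C1_atV c p (f : Sigma -> R) :
  atlas c -> dom c p -> f p != 0 -> C1_at c f p -> C1_at c (fun q => (f q)^-1) p.
Proof.
move=> ac cp f0 [g gu fg]; exists (fun v => (g v)^-1); last first.
  exact: (extends_near_comp (fun x : R => x^-1) fg).
apply: C1_nearV => //; rewrite -(nbhs_singleton fg (half_plane_coord ac cp)) /=.
by have [_ _ pK _ _] := atlas_charts ac; rewrite pK.
Qed.

Lemma C1_nearZ n u (f : R * R -> R) (g : R * R -> 'rV[R]_n) :
  C1_near u f -> C1_near u g -> C1_near u (fun v => f v *: g v).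
Proof.
move=> fu gu; apply: (@C1_near_intro _ _ _ _
  (fun a v => f v *: 'D_(vec a) g v + 'D_(vec a) f v *: g v)).
apply: filterS2 fu gu => v [cf df] [cg dg]; split=> [|a].
  exact: (cvgZ cf cg).
have [dfa cdf] := df a; have [dga cdg] := dg a; split.
  exact: is_derive_scale (derivableP dfa) (derivableP dga).
exact: (cvgD (cvgZ cf cdg) (cvgZ cdf cg)).
Qed.

Lemma C1_atM c p (f h : Sigma -> R) :
  C1_at c f p -> C1_at c h p -> C1_at c (fun q => f q * h q) p.
Proof.
move=> [g gu fg] [g' gu' fg']; exists (fun v => g v * g' v); first exact: C1_nearM.
rewrite /extends_near in fg fg' *; apply: filterS2 fg fg' => v e e' v0.
by rewrite /= -(e v0) -(e' v0).
Qed.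

Lemma C1_atZ c p n (f : Sigma -> R) (L : Sigma -> 'rV[R]_n) :
  C1_at c f p -> C1_at c L p -> C1_at c (fun q => f q *: L q) p.
Proof.
move=> [g gu fg] [g' gu' fg']; exists (fun v => g v *: g' v); first exact: C1_nearZ.
rewrite /extends_near in fg fg' *; apply: filterS2 fg fg' => v e e' v0.
by rewrite /= -(e v0) -(e' v0).
Qed.

(** The closed square of half-side [r] around [coord c p], intersected with the half plane: this is
    the origin of the maximum with 0. *)
Definition chart_rectangle c p (r : R) : set (R * R) :=
  rectangle (Num.max 0 ((coord c p).1 - r)) ((coord c p).1 + r)
    ((coord c p).2 - r) ((coord c p).2 + r).

Lemma chart_rectangle_in c p r u : half_plane u ->
  `|u.1 - (coord c p).1| <= r -> `|u.2 - (coord c p).2| <= r ->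
  chart_rectangle c p r u.
Proof.
move=> u0; rewrite !ler_distl => /andP[u1 u1'] /andP[u2 u2'].
by split; rewrite /= in_itv/= ?u1' ?u2 ?u2'// ge_max u1 andbT; exact/andP.
Qed.

Lemma chart_radius c p : atlas c -> dom c p ->
  exists2 r : R, 0 < r & chart_rectangle c p r `<=` coord c @` dom c.
Proof.
move=> ac cp; have [r r0 rD] := near_ball2 (coord_image_near ac cp).
have r20 : 0 < r / 2 by rewrite divr_gt0.
have r2r : r / 2 < r by rewrite ltr_pdivrMr// ltr_pMr// ltr1n.
exists (r / 2) => // -[x y] [] /=; rewrite !in_itv/= ge_max.
move=> /andP[/andP[x0 x1] x2] /andP[y1 y2]; apply: rD; last exact: x0.
by split; rewrite /ball/= ltr_norml; apply/andP; split; lra.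
Qed.

Definition chart_bump c p (r : R) (q : Sigma) : R :=
  if `[< dom c q >] then bump (coord c p) r (coord c q) else 0.

Lemma chart_bump_ge0 c p r q : 0 <= chart_bump c p r q.
Proof. by rewrite /chart_bump; case: ifP => // _; exact: bump_ge0. Qed.

Section OneChart.
Variables (c : chart R Sigma) (p : Sigma) (r : R).
Hypotheses (ac : atlas c) (r0 : 0 < r).
Hypothesis rD : chart_rectangle c p r `<=` coord c @` dom c.

Lemma chart_bump_eq0 q :
  ~ (param c @` chart_rectangle c p r) q -> chart_bump c p r q = 0.
Proof.
rewrite /chart_bump; case: ifP => // /asboolP cq Kq.
apply: bump_eq0 => //; have [|u1] := leP r `|(coord c q).1 - (coord c p).1|.
  by left.
have [|u2] := leP r `|(coord c q).2 - (coord c p).2|; first by right.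
exfalso; apply: Kq; have [_ _ pK _ _] := atlas_charts ac.
exists (coord c q); last exact: pK.
by apply: chart_rectangle_in; [exact: half_plane_coord|exact: ltW|exact: ltW].
Qed.

(** At a point of [dom c] the function is a bump composed with a transition. A point off [dom c]
    lies outside the closed image of the rectangle, so the extension by 0 vanishes on a
    neighbourhood. *)
Lemma chart_bump_C1 c' q : atlas c' -> dom c' q -> C1_at c' (chart_bump c p r) q.
Proof.
move=> ac' c'q; have [cq|ncq] := pselect (dom c q).
  have [U [tau [oU Uu st etau tE]]] := transition_extends ac' ac c'q cq.
  have tu := smooth_open_C1_near oU Uu st; have [ct _] := nbhs_singleton tu.
  exists (bump (coord c p) r \o tau).
    by apply: C1_near_comp2 => //; exact: bump_C1.
  apply: (extends_near_transition ac' ac c'q cq ct tE etau).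
  have := param_near ac cq openT I; apply: filterS => v Nv v0.
  have [q' [cq' _ qv vq]] := Nv v0.
  by rewrite /= vq /chart_bump asboolT// qv.
exists (cst 0); first exact: C1_near_cst.
have cK := param_rectangle_closed ac rD.
have := param_near ac' c'q (closed_openC cK) (fun Kq => ncq (param_rectangle_dom ac rD Kq)).
apply: filterS => v Nv v0; have [q' [cq' Kq' qv vq]] := Nv v0.
by rewrite /= vq chart_bump_eq0.
Qed.

Lemma chart_bump_near : dom c p -> \forall q \near p, 0 < chart_bump c p r q.
Proof.
move=> cp; have [oc _ _ cc _] := atlas_charts ac.
have nb : nbhs (coord c p) (ball (coord c p) r) by exact: nbhsx_ballx.
have nq : \forall q \near p, dom c q -> ball (coord c p) r (coord c q).
  exact: (subspace_continuousP _ _).1 cc p cp _ nb.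
have nd : \forall q \near p, dom c q by exact: open_nbhs_nbhs.
apply: filterS2 nd nq => q cq /(_ cq) bq.
by rewrite /chart_bump asboolT//; exact: bump_gt0.
Qed.

End OneChart.
End Partition.

(** * Gluing the chart integrals along a finite partition of unity *)

Theorem theorem2 (R : realType) (i : 'I_4) (hi : i != ord0)
  (Sigma : surface R) (hcompact : compact [set: Sigma])
  (horiented : oriented Sigma)
  (F : Sigma -> 'rV[R]_4) (himm : immersion F) (hspace : spacelike F)
  (hbdry : forall p : Sigma, boundary p -> de_sitter (F p))
  (horth : orthogonal_to_de_sitter F)
  (mu : {measure set (borel Sigma) -> \bar R}) (hmu : is_area_measure F mu)
  (Lb : Sigma -> 'rV[R]_4) (hLb : null_normal_field F Lb) :
  (\int[mu]_p (integrand i F Lb p)%:E = 0)%E.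
Proof.
have [sLb nLb _] := hLb.
have ca := @chart_at_atlas _ Sigma; have cd := @chart_at_dom _ Sigma.
have /choice[r rP] : forall p : Sigma, exists r : R, 0 < r /\
    chart_rectangle (chart_at p) p r `<=` coord (chart_at p) @` dom (chart_at p).
  by move=> p; have [r r0 rD] := chart_radius (ca p) (cd p); exists r.
pose psi p := chart_bump (chart_at p) p (r p).
pose N p := [set q | 0 < psi p q].
have Np p : nbhs p (N p) by exact: chart_bump_near (ca p) (rP p).1 (cd p).
(* Compactness selects finitely many cut-offs of which at least one is positive at any given point;
   their sum [s] can then be divided by. *)
have [S0 _ cover] : finite_subset_cover setT (fun p : Sigma => (N p)^°) setT.
  move: hcompact; rewrite compact_cover; apply=> [p _|p _].
    exact: open_interior.
  by exists p => //; exact: Np.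
pose S : seq Sigma := finmap.enum_fset S0.
pose s q := \sum_(p <- S) psi p q.
have s_gt0 q : 0 < s q.
  have [p pS0 /interior_subset pq] := cover q I; have pS : p \in S by exact: pS0.
  rewrite /s (big_rem p)//= ltr_pwDl//.
  by apply: sumr_ge0 => p' _; exact: chart_bump_ge0.
have psi_C1 c p q : atlas c -> dom c q -> C1_at c (psi p) q.
  by move=> ac cq; exact: (chart_bump_C1 (ca p) (rP p).1 (rP p).2 ac cq).
(* The pieces remain normal, being scalar multiples of [Lb], and they add up to [Lb] because the
   weights [psi p / s] add up to 1. *)
pose L p q := (psi p q * (s q)^-1) *: Lb q.
have LC1 c p q : atlas c -> dom c q -> C1_at c (L p) q.
  move=> ac cq; apply: C1_atZ; last exact: smooth_C1_at.
  apply: C1_atM; first exact: psi_C1.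
  apply: C1_atV => //; first by rewrite gt_eqF.
  by apply: C1_at_sum => p'; exact: psi_C1.
have Lnormal p q : normal_space F q (L p q).
  by move=> X tX; rewrite /L minkC minkZl minkC (nLb q X tX) mulr0.
have L0 p q : psi p q = 0 -> L p q = 0.
  by move=> E; rewrite /L E mul0r scale0r.
have LbE : Lb = fun q => \sum_(p <- S) L p q.
  apply/funext => q; rewrite -scaler_suml -mulr_suml divff ?scale1r//.
  exact: lt0r_neq0 (s_gt0 q).
have u_ge0 p : 0 <= (coord (chart_at p) p).1 := half_plane_coord (ca p) (cd p).
have ab p : Num.max 0 ((coord (chart_at p) p).1 - r p) < (coord (chart_at p) p).1 + r p.
  have := u_ge0 p; have := (rP p).1; rewrite gt_max => r0 u0.
  by apply/andP; split; lra.
have de p : (coord (chart_at p) p).2 - r p < (coord (chart_at p) p).2 + r p.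
  by have := (rP p).1; lra.
have supp p q : ~ (param (chart_at p) @` chart_rectangle (chart_at p) p (r p)) q -> L p q = 0.
  by move=> Kq; apply: L0; exact: (chart_bump_eq0 (ca p) (rP p).1 Kq).
have sides p u : chart_rectangle (chart_at p) p (r p) u ->
    u.1 = (coord (chart_at p) p).1 + r p \/ u.2 = (coord (chart_at p) p).2 - r p \/
    u.2 = (coord (chart_at p) p).2 + r p \/
    (u.1 = Num.max 0 ((coord (chart_at p) p).1 - r p) /\
     Num.max 0 ((coord (chart_at p) p).1 - r p) != 0) ->
    L p (param (chart_at p) u) = 0.
  move=> ru us; apply: L0; have [q cq qu] := (rP p).2 _ ru.
  have [_ _ pK _ _] := atlas_charts (ca p).
  rewrite -qu pK// /psi /chart_bump asboolT// qu; apply: bump_eq0 (rP p).1 _.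
  have r_ge0 := ltW (rP p).1.
  case: us => [->|[->|[->|[-> m0]]]].
  - by left; rewrite addrAC subrr add0r ger0_norm.
  - by right; rewrite addrAC subrr add0r normrN ger0_norm.
  - by right; rewrite addrAC subrr add0r ger0_norm.
  (* A left side not on the boundary line comes from the uncut square, so it lies at distance [r p]
     from the centre, where the bump vanishes. *)
  - left; have -> : Num.max 0 ((coord (chart_at p) p).1 - r p) = (coord (chart_at p) p).1 - r p.
      by apply/max_idPr; rewrite leNgt; apply: contra m0 => m0; rewrite max_l ?ltW.
    by rewrite addrAC subrr add0r normrN ger0_norm.
have intL p : mu.-integrable setT (EFin \o integrand i F (L p)).
  apply: (chart_integrable (ca p) i himm hspace hmu (rP p).2 (Lnormal p) _ (supp p)).
  by move=> q cq; exact: LC1.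
have int0 p : (\int[mu]_q (integrand i F (L p) q)%:E = 0)%E.
  apply: (chart_integral (ca p) i himm hspace hbdry horth hmu _ (ab p) (de p)
           (rP p).2 (Lnormal p) _ (supp p) (sides p)).
    by rewrite le_max lexx.
  by move=> q cq; exact: LC1.
transitivity (\int[mu]_q (\sum_(p <- S) (EFin \o integrand i F (L p)) q))%E.
  apply: eq_integral => q _; rewrite sumEFin; congr EFin.
  by rewrite {1}LbE; apply: integrand_sum => // p; exact: LC1.
rewrite (integral_sum measurableT intL).
by apply: big1 => p _; exact: int0.
Qed.
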